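(* Let $(M,J,g)$ be a Norden manifold and let $\nabla$ be a linear connection on $M$. Let $\tilde J$ and $\tilde g$ be the endomorphism of $T(T^{\star}(M))$ and the bilinear form on $T(T^{\star}(M))$ obtained by transporting the Norden structure $(\widehat J,\widehat g)$ of $T(M)\oplus T^{\star}(M)$ through $\Phi^{\nabla}$, i.e. $$\tilde J=\Phi^{\nabla}\circ\widehat J\circ(\Phi^{\nabla})^{-1},\qquad \tilde g=((\Phi^{\nabla})^{-1})^{\star}(\widehat g).$$ Then $(T^{\star}(M),\tilde J,\tilde g)$ is a Norden manifold.
   Context: $M$ is a smooth manifold of dimension $n$. A Norden manifold $(M,J,g)$ is an almost complex manifold $(M,J)$ (so $J:T(M)\to T(M)$, $J^2=-I$) with a pseudo-Riemannian metric $g$ such that $J$ is $g$-symmetric: $g(JX,Y)=g(X,JY)$ for all $X,Y$. Norden structure on $E=T(M)\oplus T^{\star}(M)$. Let $\flat:T(M)\to T^{\star}(M)$, $\flat(X)(Y)=g(X,Y)$, also denoted $g$, and let $\natural=\flat^{-1}:T^{\star}(M)\to T(M)$. Let $J^{\star}:T^{\star}(M)\to T^{\star}(M)$, $J^{\star}(\xi)(X)=\xi(JX)$. Define, for $X+\xi,\,Y+\eta\in E$, $$\widehat J(X+\xi)=JX+g(X)-J^{\star}(\xi),\quad\text{i.e. } \widehat J=\begin{pmatrix}J&0\\ g&-J^{\star}\end{pmatrix},$$ $$\widehat g(X+\xi,Y+\eta)=g(X,Y)+\tfrac12 g(JX,\natural\eta)+\tfrac12 g(\natural\xi,JY)+g(\natural\xi,\natural\eta).$$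 The map $\Phi^{\nabla}$. Let $\nabla$ be a linear connection on $M$, with Christoffel symbols $\Gamma^k_{il}$ given by $\nabla_{\partial/\partial x^i}\frac{\partial}{\partial x^l}=\Gamma^k_{il}\frac{\partial}{\partial x^k}$ in local coordinates $x^1,\dots,x^n$ of $M$. Let $\tilde x^1,\dots,\tilde x^n,y_1,\dots,y_n$ be the corresponding local coordinates on $T^{\star}(M)$. For each $p\in T^{\star}(M)$ lying over $x\in M$, $\Phi^{\nabla}$ gives a linear isomorphism $T_xM\oplus T_x^{\star}M\to T_p(T^{\star}(M))$ determined by $$\Phi^{\nabla}\Big(\frac{\partial}{\partial x^i}\Big)=X_i^H:=\frac{\partial}{\partial\tilde x^i}+y_k\Gamma^k_{il}\frac{\partial}{\partial y_l},\qquad \Phi^{\nabla}(dx^j)=\frac{\partial}{\partial y_j}$$ (summation over repeated indices); that is, $\Phi^\nabla$ is the $\nabla$-horizontal lift on vectors and the vertical lift on covectors. The formulas for $\tilde J$ and $\tilde g$ are understood pointwise at each $p\in T^{\star}(M)$. *)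

(* Defs.v *)
From HB Require Import structures.
From mathcomp Require Import all_boot all_order all_algebra.
From mathcomp Require Import all_classical all_reals all_analysis.

Set Implicit Arguments.
Unset Strict Implicit.
Unset Printing Implicit Defensive.

Import Order.TTheory GRing.Theory Num.Theory.
Import numFieldNormedType.Exports.

Local Open Scope classical_set_scope.
Local Open Scope ring_scope.

(* C^k and C^infinity maps on an open subset U of R^n. For k >= 1, C^k means
   differentiable with all directional derivatives of class C^(k-1). *)
Fixpoint Ck (R : realType) (n : nat) (W : normedModType R) (k : nat)
    (U : set 'rV[R]_n) (f : 'rV[R]_n -> W) : Prop :=
  match k with
  | 0%N => forall x, U x -> {for x, continuous f}
  | k'.+1 => (forall x, U x -> differentiable f x) /\
             (forall v : 'rV[R]_n, Ck k' U ('D_v f))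
  end.

Definition smooth_on (R : realType) (n : nat) (W : normedModType R)
    (U : set 'rV[R]_n) (f : 'rV[R]_n -> W) : Prop :=
  forall k, Ck k U f.

(* A set with an atlas of R^n-valued charts. The chart with index a is cmap a,
   restricted to its domain cdom a; cinv a is its inverse, with arbitrary values
   outside of the image of the chart. chart_at x is a chosen chart around x, used
   to represent the tangent space at x (see tangent). The conditions that make
   this a smooth manifold are in smooth_manifold. *)
Record chartedSpace (R : realType) (n : nat) := ChartedSpace {
  carrier :> Type;
  chart : Type;
  cdom : chart -> set carrier;
  cmap : chart -> carrier -> 'rV[R]_n;
  cinv : chart -> 'rV[R]_n -> carrier;
  chart_at : carrier -> chart }.

Section Manifold.
Variables (R : realType) (n : nat) (M : chartedSpace R n).
Implicit Types (x : M) (a b : chart M) (U : set M).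

(* The image in R^n, under the chart a, of the part of U in its domain. *)
Definition cimg a U : set 'rV[R]_n := cmap a @` (U `&` cdom a).

(* The topology of M is the one defined by the atlas. *)
Definition mopen U : Prop := forall a, open (cimg a U).

Definition smooth_manifold : Prop :=
  (forall x, cdom (chart_at x) x) /\
  (forall a x, cdom a x -> cinv a (cmap a x) = x) /\
  (forall a b, open (cimg a (cdom b))) /\
  (forall a b, smooth_on (cimg a (cdom b)) (cmap b \o cinv a)) /\
  (forall x y, x <> y ->
    exists U V, mopen U /\ mopen V /\ U x /\ V y /\ U `&` V = set0) /\
  (exists B : nat -> set M, (forall k, mopen (B k)) /\
    forall U x, mopen U -> U x -> exists k, B k x /\ B k `<=` U).

(* T_x M: a tangent vector at x is represented by its components in the chart
   chart_at x. Components in other charts are obtained by differentiating the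
   change of coordinates, see tcomp and tvec. *)
Definition tangent (x : M) : Type := 'rV[R]_n.
HB.instance Definition _ x := Vector.copy (tangent x) 'rV[R]_n.

Definition cotangent x : Type := 'Hom(tangent x, R^o).
HB.instance Definition _ x := Vector.copy (cotangent x) 'Hom(tangent x, R^o).

(* The components in the chart a of a tangent vector at x. *)
Definition tcomp a x (X : tangent x) : 'rV[R]_n :=
  'd (cmap a \o cinv (chart_at x)) (cmap (chart_at x) x) X.

(* The tangent vector at x whose components in the chart a are v. *)
Definition tvec a x (v : 'rV[R]_n) : tangent x :=
  'd (cmap (chart_at x) \o cinv a) (cmap a x) v.

(* The coordinate vector field d/dx^i of the chart a. *)
Definition partial a (i : 'I_n) x : tangent x := tvec a x (delta_mx 0 i).

Definition smooth_fun U (f : M -> R) : Prop :=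
  forall a, smooth_on (cimg a U) (f \o cinv a : 'rV[R]_n -> R^o).

Definition vfield : Type := forall x, tangent x.

Definition smooth_vfield U (X : vfield) : Prop :=
  forall a, smooth_on (cimg a U) (fun v => tcomp a (X (cinv a v))).

Definition endo : Type := forall x, 'End(tangent x).

Definition smooth_endo (J : endo) : Prop :=
  forall a (i : 'I_n), smooth_on (cimg a setT)
    (fun v => tcomp a (J (cinv a v) (partial a i (cinv a v)))).

(* A bilinear form g on the tangent spaces, in curried form: g x X is the
   covector Y |-> g(X, Y), so that g x is the map "flat" of g at x. *)
Definition biform : Type := forall x, 'Hom(tangent x, cotangent x).

Definition gpair (g : biform) x (X Y : tangent x) : R :=
  (g x X : 'Hom(tangent x, R^o)) Y.

Definition smooth_biform (g : biform) : Prop :=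
  forall a (i j : 'I_n), smooth_on (cimg a setT)
    (fun v => gpair g (partial a i (cinv a v)) (partial a j (cinv a v)) : R^o).

Definition almost_complex (J : endo) : Prop :=
  smooth_endo J /\ forall x (X : tangent x), J x (J x X) = - X.

Definition pseudo_riemannian (g : biform) : Prop :=
  smooth_biform g /\
  (forall x (X Y : tangent x), gpair g X Y = gpair g Y X) /\
  (forall x (X : tangent x), (forall Y, gpair g X Y = 0) -> X = 0).

Definition norden_manifold (J : endo) (g : biform) : Prop :=
  smooth_manifold /\ almost_complex J /\ pseudo_riemannian g /\
  (forall x (X Y : tangent x), gpair g (J x X) Y = gpair g X (J x Y)).

(* The derivative at x of the function f along the tangent vector X. *)
Definition tderiv x (X : tangent x) (f : M -> R) : R :=
  'd (f \o cinv (chart_at x) : 'rV[R]_n -> R^o) (cmap (chart_at x) x) X.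

(* A linear connection, as an operator (X, Y) |-> nabla_X Y on vector fields
   defined and smooth on an arbitrary open set U of M, compatible with
   restrictions. Vector fields on U are represented by total sections of TM
   whose values outside of U are irrelevant. *)
Definition linear_connection (nabla : vfield -> vfield -> vfield) : Prop :=
  forall U, mopen U ->
  forall X X' Y Y' : vfield, smooth_vfield U X -> smooth_vfield U X' ->
    smooth_vfield U Y -> smooth_vfield U Y' ->
  forall f : M -> R, smooth_fun U f ->
  [/\ (forall x, U x -> X x = X' x) -> (forall x, U x -> Y x = Y' x) ->
        forall x, U x -> nabla X Y x = nabla X' Y' x,
      smooth_vfield U (nabla X Y),
      forall x, U x ->
        nabla (fun z => f z *: X z + X' z) Y x
          = f x *: nabla X Y x + nabla X' Y x,
      forall x, U x ->
        nabla X (fun z => Y z + Y' z) x = nabla X Y x + nabla X Y' x &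
      forall x, U x ->
        nabla X (fun z => f z *: Y z) x
          = tderiv (X x) f *: Y x + f x *: nabla X Y x].

(* Gamma^k_il at x in the chart a. *)
Definition christoffel (nabla : vfield -> vfield -> vfield) a x (k i l : 'I_n)
    : R :=
  tcomp a (nabla (partial a i) (partial a l) x) 0 k.

(* The covector sum_i y_i dx^i at x, in the chart a. *)
Definition cvec a x (y : 'rV[R]_n) : cotangent x :=
  linfun (fun X : tangent x => \sum_i y 0 i * tcomp a X 0 i : R^o).

(* The component y_i of a covector at x, in the chart a. *)
Definition ccomp a x (xi : cotangent x) (i : 'I_n) : R :=
  (xi : 'Hom(tangent x, R^o)) (partial a i x).

(* The fibre at x of E = T(M) (+) T*(M), and the Norden structure of E. Here and
   below, linfun only packages functions that are linear; in natural and in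
   Jtilde, gtilde, ^-1 is applied to isomorphisms. *)
Definition bigtangent x : Type := (tangent x * cotangent x)%type.
HB.instance Definition _ x :=
  Vector.copy (bigtangent x) (tangent x * cotangent x)%type.

Definition Jstar (J : endo) x (xi : cotangent x) : cotangent x :=
  ((xi : 'Hom(tangent x, R^o)) \o J x)%VF.

Definition natural (g : biform) x : 'Hom(cotangent x, tangent x) :=
  (g x)^-1%VF.

Definition Jhat_fun (J : endo) (g : biform) x (u : bigtangent x) :
    bigtangent x :=
  (J x u.1, g x u.1 - Jstar J u.2).

Definition Jhat (J : endo) (g : biform) x : 'End(bigtangent x) :=
  linfun (Jhat_fun J g (x := x)).

Definition ghat (J : endo) (g : biform) x (u v : bigtangent x) : R :=
  gpair g u.1 v.1
  + 2^-1 * gpair g (J x u.1) (natural g x v.2)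
  + 2^-1 * gpair g (natural g x u.2) (J x v.1)
  + gpair g (natural g x u.2) (natural g x v.2).

End Manifold.

(* The total space T*M with its coordinates (x^1, .., x^n, y_1, .., y_n). *)
Definition cotangent_bundle (R : realType) (n : nat) (M : chartedSpace R n) :
    chartedSpace R (n + n) :=
  {| carrier := {x : M & cotangent x};
     chart := chart M;
     cdom := fun a => [set p | cdom a (tag p)];
     cmap := fun a p =>
       row_mx (cmap a (tag p)) (\row_i ccomp a (tagged p) i);
     cinv := fun a w =>
       Tagged (@cotangent R n M) (cvec a (cinv a (lsubmx w)) (rsubmx w));
     chart_at := fun p => chart_at (tag p) |}.

Section Transport.
Variables (R : realType) (n : nat) (M : chartedSpace R n).
Local Notation TsM := (cotangent_bundle M).
Implicit Types (J : endo M) (g : biform M).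
Variable nabla : vfield M -> vfield M -> vfield M.

(* The point of M below p. *)
Definition base (p : TsM) : M := tag p.

(* X_i^H = d/dx~^i + y_k Gamma^k_il d/dy_l at p, in the chart a. *)
Definition hlift (a : chart M) (p : TsM) (i : 'I_n) : tangent p :=
  @partial R (n + n) TsM a (lshift n i) p
  + \sum_k \sum_l (ccomp a (tagged p) k * christoffel nabla a (base p) k i l)
      *: @partial R (n + n) TsM a (rshift n l) p.

(* Phi^nabla at p, in the chart a: d/dx^i |-> X_i^H and dx^j |-> d/dy_j. *)
Definition Phi_chart (a : chart M) (p : TsM) (u : bigtangent (base p)) :
    tangent p :=
  \sum_i tcomp a u.1 0 i *: hlift a p i
  + \sum_j ccomp a u.2 j *: @partial R (n + n) TsM a (rshift n j) p.

(* The horizontal and vertical lifts do not depend on the chart around p used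
   to write them; any one serves. *)
Definition Phi (p : TsM) : 'Hom(bigtangent (base p), tangent p) :=
  linfun (Phi_chart (chart_at (base p)) (p := p)).

Definition Jtilde J g : endo TsM :=
  fun p => (Phi p \o Jhat J g (base p) \o (Phi p)^-1)%VF.

Definition gtilde J g : biform TsM :=
  fun p => linfun (fun U : tangent p =>
    linfun (fun V : tangent p =>
      ghat J g ((Phi p)^-1%VF U) ((Phi p)^-1%VF V) : R^o) : cotangent p).

End Transport.

(* Main.v *)
Require Import Defs.
From HB Require Import structures.
From mathcomp Require Import all_boot all_order all_algebra.
From mathcomp Require Import all_classical all_reals all_analysis.
From mathcomp Require Import ring.

(** The statement splits into algebra on each fibre of TM + T*M and analysis
    on T*M.

    The algebra does not involve the connection. Writing A for the vector
    natural xi, the map Jhat sends (X, A) to (J X, X - J A), and everything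
    follows from J^2 = -1 and the g-symmetry of J: Jhat^2 = -1 ([Jhat_sq]),
    ghat is symmetric ([ghat_sym]) and Jhat is ghat-symmetric ([ghat_Jhat]). If
    (X, A) is ghat-orthogonal to everything, then A = - J X / 2 and
    X = - J A / 2, whence X = - X / 4 and X = A = 0 ([ghat_nondegenerate]). As
    Phi is a fibrewise isomorphism ([PhiK], [PhiVK]), these identities pass to
    Jtilde and gtilde.

    The analysis consists of two facts. First, T*M is a smooth manifold
    ([cotangent_manifold]): its transition maps send (x, y) to (phi x, y P(x))
    with P the Jacobian matrix of the inverse of phi. Second, Jtilde and gtilde
    have smooth components in the charts of T*M. The crux is that Phi has the
    same expression in every chart a around the base point, namely
    (X, eta) |-> (X, sum_i X_i N_i + eta) with N_il = sum_k y_k Gamma^k_il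
    ([tcomp_Phi]), although it is defined by means of one chosen chart at each
    point. To compare the charts a and c, write the coordinate field d/da^m as
    sum_l P_lm d/dc^l. The Leibniz rule gives
    xi(nabla_X d/da^m) = sum_l (X . P_lm) xi_l + P_lm xi(nabla_X d/dc^l)
    ([hcoef_change]), and the derivative of the transition map of T*M produces
    exactly the same terms ([dcotangent_transition_r]). Consequently Phi and
    its inverse are, in each chart, polynomial in the fibre coordinates and in
    the Christoffel symbols, and the components of Jtilde and gtilde are smooth
    functions of those of J, g, the inverse of g and nabla. *)

Set Implicit Arguments.
Unset Strict Implicit.
Unset Printing Implicit Defensive.

Import Order.TTheory GRing.Theory Num.Theory.
Import numFieldNormedType.Exports.

Local Open Scope classical_set_scope.
Local Open Scope ring_scope.

(** * Linear maps and matrices *)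

(** [lfunE] for a function that is only known to be linear. *)
Lemma linfunE_linear (K : fieldType) (aT rT : vectType K) (f : aT -> rT) :
  linear f -> linfun f =1 f.
Proof.
move=> lf; pose F := GRing.isLinear.Build K aT rT *:%R f lf.
pose L : {linear aT -> rT} := HB.pack f F.
exact: (lfunE L).
Qed.

(** [f^-1] is a right inverse of [f] at the values of [f]. *)
Lemma surj_lfunVK (K : fieldType) (aT rT : vectType K) (f : 'Hom(aT, rT)) u v :
  f v = u -> f (f^-1%VF u) = u.
Proof. by move=> <-; rewrite limg_lfunVK // memv_img // memvf. Qed.

Lemma unitmx_of_inj (F : fieldType) n (A : 'M[F]_n) :
  (forall v : 'rV_n, v *m A = 0 -> v = 0) -> A \in unitmx.
Proof.
move=> injA; rewrite -row_free_unit -kermx_eq0.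
by apply/rowV0P => v /sub_kermxP/injA.
Qed.

(** * Differentials depend only on germs *)

Section NearEq.
Variables (R : numFieldType) (V W : normedModType R).

(** The differential of [f] at [x] gives a first-order expansion of any
    function [g] that agrees with [f] near [x]. *)
Lemma near_eq_diff_locally (f g : V -> W) (x : V) :
  (\forall y \near x, f y = g y) -> differentiable f x ->
  g \o shift x = cst (g x) + 'd f x +o_ 0 id.
Proof.
move=> fg df; have fgx : f x = g x by exact: nbhs_singleton fg.
have /eqaddoP Hf := diff_locally df.
apply/eqaddoP => e e0; have := Hf e e0.
have : \forall h \near 0, f (h + x) = g (h + x).
  by move: fg; rewrite (near_shift 0 x) subr0.
move=> H1 H2; near=> h.
have E1 : f (h + x) = g (h + x) by near: h.
have : `|(f \o shift x - (cst (f x) + 'd f x)) h| <= e * `|id h|.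
  by near: h; exact: H2.
by rewrite /= !fctE /= E1 fgx.
Unshelve. all: by end_near. Qed.

Lemma near_eq_diff (f g : V -> W) (x : V) :
  (\forall y \near x, f y = g y) -> differentiable f x ->
  'd g x = 'd f x :> (V -> W).
Proof.
move=> fg df; apply: diff_unique; first exact: diff_continuous.
exact: near_eq_diff_locally.
Qed.

Lemma near_eq_differentiable (f g : V -> W) (x : V) :
  (\forall y \near x, f y = g y) -> differentiable f x -> differentiable g x.
Proof.
move=> fg df; apply/diff_locallyP; rewrite (near_eq_diff fg df); split.
  exact: diff_continuous.
exact: near_eq_diff_locally.
Qed.

End NearEq.

Section DiffAt.
Variable R : numFieldType.

Lemma near_eq_diff_at (V W : normedModType R) (f g : V -> W) (x v : V) :
  (\forall y \near x, f y = g y) -> differentiable f x -> 'd g x v = 'd f x v.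
Proof. by move=> fg df; rewrite (near_eq_diff fg df). Qed.

(** The chain rule, with the intermediate point [y] up to equality. *)
Lemma diff_comp_at (U V W : normedModType R) (f : U -> V) (g : V -> W) x y v :
  f x = y -> differentiable f x -> differentiable g (f x) ->
  'd g y ('d f x v) = 'd (g \o f) x v.
Proof. by move=> <- df dg; rewrite (diff_comp df dg). Qed.

Lemma diff_id_at (V : normedModType R) (x v : V) : 'd id x v = v.
Proof. by rewrite (@diff_val _ _ _ _ _ (@id V) id). Qed.

End DiffAt.

(* Differentials are chosen by an epsilon operator; unfolding them during
   unification is useless and very costly. *)
Local Opaque diff.

(** * Functions of class C^k on an open set *)

Section Ck.
Variables (R : realType) (n : nat) (W : normedModType R).
Implicit Types (U V : set 'rV[R]_n) (f g : 'rV[R]_n -> W).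

(** Being C^k on an open set only depends on the values on this set. *)
Lemma Ck_ext k U f g : open U -> (forall x, U x -> f x = g x) ->
  Ck k U f -> Ck k U g.
Proof.
move=> oU; elim: k f g => [|k IH] f g fg.
  move=> cf x Ux.
  have nfg : \forall y \near x, f y = g y.
    by apply: filterS (open_nbhs_nbhs (conj oU Ux)).
  rewrite /prop_for /continuous_at -(fg _ Ux); apply: cvg_trans (cf _ Ux).
  exact: near_eq_cvg nfg.
move=> [df Df]; split=> [x Ux|v].
  apply: near_eq_differentiable (df _ Ux).
  by apply: filterS (open_nbhs_nbhs (conj oU Ux)).
apply: IH (Df v) => x Ux; apply: near_eq_derive.
by apply: filterS (open_nbhs_nbhs (conj oU Ux)).
Qed.

Lemma Ck_sub k U V f : V `<=` U -> Ck k U f -> Ck k V f.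
Proof.
move=> VU; elim: k f => [|k IH] f /=; first by move=> H x /VU/H.
by case=> df Df; split=> [x /VU/df//|v]; exact: IH.
Qed.

Lemma Ck_pred k U f : Ck k.+1 U f -> Ck k U f.
Proof.
elim: k f => [|k IH] f.
  by move=> [df _] x Ux; apply/differentiable_continuous/df.
by move=> [df Df]; split=> // v; exact/IH/Df.
Qed.

Lemma Ck_cst k U (c : W) : Ck k U (cst c).
Proof.
elim: k c => [|k IH] c; first by move=> x Ux; exact: cst_continuous.
split=> [x Ux|v]; first exact: differentiable_cst.
rewrite (_ : 'D_v (cst c) = cst 0) //.
by apply/funext => x; exact: derive_cst.
Qed.

Lemma Ck_add k U f g : open U -> Ck k U f -> Ck k U g ->
  Ck k U (fun x => f x + g x).
Proof.
move=> oU; elim: k f g => [|k IH] f g.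
  by move=> cf cg x Ux; apply: continuousD; [exact: cf|exact: cg].
move=> [df Df] [dg Dg]; split=> [x Ux|v].
  by apply: differentiableD; [exact: df|exact: dg].
apply: Ck_ext oU _ (IH _ _ (Df v) (Dg v)) => x Ux; apply/esym.
by apply: deriveD; apply: diff_derivable; [exact: df|exact: dg].
Qed.

(** A C^k scalar function times a constant vector. *)
Lemma Ck_scaler k U (f : 'rV[R]_n -> R^o) (w : W) : open U -> Ck k U f ->
  Ck k U (fun x => f x *: w).
Proof.
move=> oU; elim: k f => [|k IH] f.
  by move=> cf x Ux; exact: cvgZr_tmp (cf x Ux).
move=> [df Df]; split=> [x Ux|v].
  by apply: differentiableZl; exact: df.
apply: Ck_ext oU _ (IH _ (Df v)) => x Ux.
have dZ : differentiable (fun y => f y *: w) x.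
  by apply: differentiableZl; exact: df.
by rewrite [RHS](deriveE _ dZ) (diffZl _ (df _ Ux)) (deriveE _ (df _ Ux)).
Qed.

Lemma Ck_sum k U (I : Type) (r : seq I) (P : pred I) (F : I -> 'rV[R]_n -> W) :
  open U -> (forall i, P i -> Ck k U (F i)) ->
  Ck k U (fun x => \sum_(i <- r | P i) F i x).
Proof.
move=> oU cF; elim: r => [|i r IH].
  by apply: Ck_ext oU _ (@Ck_cst k U 0) => x Ux; rewrite big_nil.
have [Pi|nPi] := boolP (P i).
  by apply: Ck_ext oU _ (Ck_add oU (cF i Pi) IH) => x Ux; rewrite big_cons Pi.
by apply: Ck_ext oU _ IH => x Ux; rewrite big_cons (negbTE nPi).
Qed.

End Ck.

Section CkScalar.
Variables (R : realType) (n : nat).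
Implicit Types (U V : set 'rV[R]_n) (f g : 'rV[R]_n -> R^o).

Lemma Ck_mul k U f g : open U -> Ck k U f -> Ck k U g ->
  Ck k U (fun x => f x * g x : R^o).
Proof.
move=> oU; elim: k f g => [|k IH] f g.
  by move=> cf cg x Ux; apply: (@continuousM R); [exact: cf|exact: cg].
move=> fk gk; have [df Df] := fk; have [dg Dg] := gk.
split=> [x Ux|v].
  by apply: (@differentiableM R); [exact: df|exact: dg].
have H := Ck_add oU (IH _ _ (Ck_pred fk) (Dg v)) (IH _ _ (Ck_pred gk) (Df v)).
apply: Ck_ext oU _ H => x Ux; apply/esym.
by apply: deriveM; apply: diff_derivable; [exact: df|exact: dg].
Qed.

Lemma Ck_opp k U f : open U -> Ck k U f -> Ck k U (fun x => - f x).
Proof.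
move=> oU cf; apply: Ck_ext oU _ (Ck_mul oU (@Ck_cst _ _ _ k U (-1 : R^o)) cf).
by move=> x _; rewrite /= mulN1r.
Qed.

Lemma Ck_inv k U f : open U -> (forall x, U x -> f x != 0) ->
  Ck k U f -> Ck k U (fun x => (f x)^-1 : R^o).
Proof.
move=> oU f0; elim: k f f0 => [|k IH] f f0.
  move=> cf x Ux; apply: (@continuousV R); [exact: f0|exact: cf].
move=> fk; have [df Df] := fk.
split=> [x Ux|v].
  by apply: (@differentiableV R); [exact: df|exact: f0].
have H1 := IH _ f0 (Ck_pred fk).
(* The derivative of 1/f is - (1/f) (1/f) f'. *)
have H := Ck_opp oU (Ck_mul oU (Ck_mul oU H1 H1) (Df v)).
apply: Ck_ext oU _ H => x Ux.
rewrite (deriveV (f0 _ Ux)); last by apply: diff_derivable; exact: df.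
by rewrite scaleNr -exprVn expr2.
Qed.

Lemma Ck_prod k U (I : Type) (r : seq I) (P : pred I)
    (F : I -> 'rV[R]_n -> R^o) :
  open U -> (forall i, P i -> Ck k U (F i)) ->
  Ck k U (fun x => \prod_(i <- r | P i) F i x : R^o).
Proof.
move=> oU cF; elim: r => [|i r IH].
  by apply: Ck_ext oU _ (@Ck_cst _ _ _ k U (1 : R^o)) => x Ux; rewrite big_nil.
have [Pi|nPi] := boolP (P i).
  by apply: Ck_ext oU _ (Ck_mul oU (cF i Pi) IH) => x Ux; rewrite big_cons Pi.
by apply: Ck_ext oU _ IH => x Ux; rewrite big_cons (negbTE nPi).
Qed.

Lemma derive_coord (i : 'I_n) (v x : 'rV[R]_n) :
  'D_v (fun y : 'rV[R]_n => y 0 i : R^o) x = v 0 i.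
Proof.
have := derive_mx (@derivable_id _ _ x v); rewrite derive_id => /matrixP.
by move=> /(_ 0 i); rewrite mxE => ->.
Qed.

Lemma Ck_coord k U (i : 'I_n) : Ck k U (fun y : 'rV[R]_n => y 0 i : R^o).
Proof.
case: k => [|k]; first by move=> x _; exact: coord_continuous.
split=> [x _|v]; first exact: differentiable_coord.
rewrite (_ : 'D_v _ = cst (v 0 i)); first exact: Ck_cst.
by apply/funext => x; rewrite derive_coord.
Qed.

End CkScalar.

Section CkVector.
Variables (R : realType) (n : nat).
Implicit Types (U : set 'rV[R]_n).

Lemma derive_row_coord m (f : 'rV[R]_n -> 'rV[R]_m) (x v : 'rV[R]_n) j :
  differentiable f x -> 'D_v (fun y => f y 0 j : R^o) x = ('D_v f x) 0 j.
Proof.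
by move=> df; rewrite (derive_mx (diff_derivable df)) mxE.
Qed.

Lemma Ck_row_coord k U m (f : 'rV[R]_n -> 'rV[R]_m) j : open U -> Ck k U f ->
  Ck k U (fun x => f x 0 j : R^o).
Proof.
move=> oU; elim: k f => [|k IH] f.
  move=> cf x Ux.
  exact: (@continuous_comp _ _ _ f (fun y : 'rV[R]_m => y 0 j : R^o) x
    (cf x Ux) (@coord_continuous _ _ _ 0 j _)).
move=> [df Df]; split=> [x Ux|v].
  exact: (@differentiable_comp _ _ _ _ f (fun y : 'rV[R]_m => y 0 j : R^o) x
    (df x Ux) (differentiable_coord _ 0 j)).
apply: Ck_ext oU _ (IH _ (Df v)) => x Ux.
by rewrite (derive_row_coord _ _ (df _ Ux)).
Qed.

Lemma Ck_row k U m (f : 'rV[R]_n -> 'rV[R]_m) : open U ->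
  (forall j, Ck k U (fun x => f x 0 j : R^o)) -> Ck k U f.
Proof.
move=> oU cf.
have H : Ck k U (fun x => \sum_j (f x 0 j : R^o) *: (delta_mx 0 j : 'rV[R]_m)).
  by apply: Ck_sum => // j _; apply: Ck_scaler.
by apply: Ck_ext oU _ H => x _; rewrite -row_sum_delta.
Qed.

Lemma derive_comp_row m (W : normedModType R) (phi : 'rV[R]_n -> 'rV[R]_m)
    (f : 'rV[R]_m -> W) (x v : 'rV[R]_n) :
  differentiable phi x -> differentiable f (phi x) ->
  'D_v (f \o phi) x =
    \sum_j ('D_v phi x) 0 j *: 'D_(delta_mx 0 j) f (phi x).
Proof.
move=> dphi df; have dc := differentiable_comp dphi df.
rewrite (deriveE _ dc) (diff_comp dphi df) /= -(deriveE _ dphi).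
rewrite [X in 'd f _ X]row_sum_delta linear_sum; apply: eq_bigr => j _.
by rewrite linearZ (deriveE _ df).
Qed.

(** By induction on [k], as the partial derivatives of the composite are
    sums of products of derivatives of [phi] and of composites with [phi]. *)
Lemma Ck_comp k U m (V : set 'rV[R]_m) (phi : 'rV[R]_n -> 'rV[R]_m)
    (f : 'rV[R]_m -> R^o) : open U -> open V ->
  (forall x, U x -> V (phi x)) ->
  Ck k U phi -> Ck k V f -> Ck k U (f \o phi).
Proof.
move=> oU oV phiV; elim: k f => [|k IH] f.
  by move=> cphi cf x Ux; apply: continuous_comp;
    [exact: cphi|exact/cf/phiV].
move=> cphi cf; have [dphi Dphi] := cphi; have [df Df] := cf.
split=> [x Ux|v].
  by apply: differentiable_comp; [exact: dphi|exact/df/phiV].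
have H : Ck k U (fun x => \sum_j ('D_v phi x) 0 j *
    ('D_(delta_mx 0 j) f \o phi) x : R^o).
  apply: Ck_sum => // j _; apply: Ck_mul => //.
    exact: Ck_row_coord (Dphi v).
  by apply: IH; [exact: Ck_pred|exact: Df].
apply: Ck_ext oU _ H => x Ux.
by rewrite (derive_comp_row v (dphi _ Ux) (df _ (phiV _ Ux))).
Qed.

End CkVector.

Section Smooth.
Variables (R : realType) (n : nat).
Implicit Types (U : set 'rV[R]_n) (f g : 'rV[R]_n -> R^o).

Lemma smooth_ext (W : normedModType R) U (f g : 'rV[R]_n -> W) :
  open U -> (forall x, U x -> f x = g x) -> smooth_on U f -> smooth_on U g.
Proof. by move=> oU fg sf k; exact: Ck_ext fg (sf k). Qed.

Lemma smooth_sub (W : normedModType R) U V (f : 'rV[R]_n -> W) :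
  V `<=` U -> smooth_on U f -> smooth_on V f.
Proof. by move=> VU sf k; exact: Ck_sub VU (sf k). Qed.

Lemma smooth_cst (W : normedModType R) U (c : W) : smooth_on U (cst c).
Proof. by move=> k; exact: Ck_cst. Qed.

Lemma smoothD U f g : open U -> smooth_on U f -> smooth_on U g ->
  smooth_on U (fun x => f x + g x : R^o).
Proof. by move=> oU sf sg k; exact: Ck_add oU (sf k) (sg k). Qed.

Lemma smoothN U f : open U -> smooth_on U f ->
  smooth_on U (fun x => - f x : R^o).
Proof. by move=> oU sf k; exact: Ck_opp oU (sf k). Qed.

Lemma smoothB U f g : open U -> smooth_on U f -> smooth_on U g ->
  smooth_on U (fun x => f x - g x : R^o).
Proof. by move=> oU sf sg; apply: smoothD => //; exact: smoothN. Qed.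

Lemma smoothM U f g : open U -> smooth_on U f -> smooth_on U g ->
  smooth_on U (fun x => f x * g x : R^o).
Proof. by move=> oU sf sg k; exact: Ck_mul oU (sf k) (sg k). Qed.

Lemma smooth_inv U f : open U -> (forall x, U x -> f x != 0) ->
  smooth_on U f -> smooth_on U (fun x => (f x)^-1 : R^o).
Proof. by move=> oU f0 sf k; exact: Ck_inv oU f0 (sf k). Qed.

Lemma smooth_sum U (I : Type) (r : seq I) (P : pred I)
    (F : I -> 'rV[R]_n -> R^o) :
  open U -> (forall i, P i -> smooth_on U (F i)) ->
  smooth_on U (fun x => \sum_(i <- r | P i) F i x : R^o).
Proof. by move=> oU sF k; apply: Ck_sum => // i /sF; exact. Qed.

Lemma smooth_prod U (I : Type) (r : seq I) (P : pred I)
    (F : I -> 'rV[R]_n -> R^o) :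
  open U -> (forall i, P i -> smooth_on U (F i)) ->
  smooth_on U (fun x => \prod_(i <- r | P i) F i x : R^o).
Proof. by move=> oU sF k; apply: Ck_prod => // i /sF; exact. Qed.

Lemma smooth_coord U (i : 'I_n) : smooth_on U (fun y => y 0 i : R^o).
Proof. by move=> k; exact: Ck_coord. Qed.

Lemma smooth_row_coord U m (f : 'rV[R]_n -> 'rV[R]_m) j : open U ->
  smooth_on U f -> smooth_on U (fun x => f x 0 j : R^o).
Proof. by move=> oU sf k; exact: Ck_row_coord oU (sf k). Qed.

Lemma smooth_row U m (f : 'rV[R]_n -> 'rV[R]_m) : open U ->
  (forall j, smooth_on U (fun x => f x 0 j : R^o)) -> smooth_on U f.
Proof. by move=> oU sf k; apply: Ck_row => // j; exact: sf. Qed.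

Lemma smooth_comp U m (V : set 'rV[R]_m) (phi : 'rV[R]_n -> 'rV[R]_m)
    (f : 'rV[R]_m -> R^o) : open U -> open V ->
  (forall x, U x -> V (phi x)) ->
  smooth_on U phi -> smooth_on V f -> smooth_on U (f \o phi).
Proof. by move=> oU oV pV sp sf k; exact: Ck_comp oU oV pV (sp k) (sf k). Qed.

Lemma smooth_differentiable (W : normedModType R) U (f : 'rV[R]_n -> W) x :
  smooth_on U f -> U x -> differentiable f x.
Proof. by move=> /(_ 1%N)[df _] /df. Qed.

Lemma smooth_diff (W : normedModType R) U (f : 'rV[R]_n -> W) v : open U ->
  smooth_on U f -> smooth_on U (fun x => 'd f x v).
Proof.
move=> oU sf; apply: (@smooth_ext _ _ ('D_v f)) => //.
  by move=> x Ux; rewrite deriveE //; exact: smooth_differentiable sf Ux.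
by move=> k; have [_] := sf k.+1; apply.
Qed.

End Smooth.

Section SmoothMatrix.
Variables (R : realType) (n : nat) (O : set 'rV[R]_n).
Hypothesis oO : open O.

Lemma smooth_det m (A : 'rV[R]_n -> 'M[R]_m) :
  (forall i j, smooth_on O (fun w => A w i j : R^o)) ->
  smooth_on O (fun w => \det (A w) : R^o).
Proof.
move=> sA; apply: smooth_sum => // s _; apply: smoothM => //.
  exact: smooth_cst.
by apply: smooth_prod => // i _; exact: sA.
Qed.

(** By Cramer's formula, the entries of the inverse are cofactors divided
    by the determinant. *)
Lemma smooth_invmx m (A : 'rV[R]_n -> 'M[R]_m) :
  (forall w, O w -> A w \in unitmx) ->
  (forall i j, smooth_on O (fun w => A w i j : R^o)) ->
  forall i j, smooth_on O (fun w => invmx (A w) i j : R^o).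
Proof.
move=> uA sA i j.
have sdet : smooth_on O (fun w => (\det (A w))^-1 : R^o).
  apply: smooth_inv => //; last exact: smooth_det.
  by move=> w /uA; rewrite unitmxE unitfE.
have scof : smooth_on O (fun w => cofactor (A w) j i : R^o).
  apply: smoothM => //; first exact: smooth_cst.
  apply: smooth_det => k l.
  by apply: smooth_ext (sA (lift j k) (lift i l)) => // w _; rewrite !mxE.
apply: smooth_ext oO _ (smoothM oO sdet scof) => w /uA uw.
by rewrite /invmx uw !mxE.
Qed.

End SmoothMatrix.

Section DeriveSum.
Variables (R : realType) (V : normedModType R).

Lemma derive_sum_mul m (f g : 'I_m -> V -> R^o) (x v : V) :
  (forall i, differentiable (f i) x) -> (forall i, differentiable (g i) x) ->
  'D_v (fun y => \sum_i f i y * g i y : R^o) x =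
    \sum_i ('D_v (f i) x * g i x + f i x * 'D_v (g i) x).
Proof.
move=> df dg.
have -> : (fun y => \sum_i f i y * g i y : R^o) = \sum_i (f i * g i).
  by apply/funext => y; rewrite fct_sumE.
have dfv i : derivable (f i) x v by exact: diff_derivable.
have dgv i : derivable (g i) x v by exact: diff_derivable.
rewrite derive_sum; last by move=> i; exact: derivableM.
apply: eq_bigr => i _; rewrite deriveM // addrC.
by congr (_ + _); rewrite /GRing.scale /= mulrC.
Qed.

End DeriveSum.

Lemma derive_lsubmx (R : realType) m k (F : 'rV[R]_m -> R^o)
    (w v : 'rV[R]_(m + k)) :
  'D_v (fun y => F (lsubmx y)) w = 'D_(lsubmx v) F (lsubmx w).
Proof.
rewrite /derive; under eq_fun => h.
  rewrite /= (_ : lsubmx (h *: v + w) = h *: lsubmx v + lsubmx w); last first.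
    by apply/rowP => j; rewrite !mxE.
  over.
by [].
Qed.

(** * Charts, tangent vectors and changes of coordinates *)

(** The conditions for a smooth manifold that concern the charts only,
    without separation and countability of the topology. They suffice for
    the theory of tangent vectors below. *)
Definition smooth_atlas (R : realType) (n : nat) (M : chartedSpace R n) :
    Prop :=
  (forall x : M, cdom (chart_at x) x) /\
  (forall (a : chart M) x, cdom a x -> cinv a (cmap a x) = x) /\
  (forall a b : chart M, open (cimg a (cdom b))) /\
  (forall a b : chart M, smooth_on (cimg a (cdom b)) (cmap b \o cinv a)).

Section Atlas.
Variables (R : realType) (n : nat) (M : chartedSpace R n).
Hypothesis atlasM : smooth_atlas M.
Implicit Types (x y : M) (a b c : chart M) (U V : set M).

Lemma cdom_chart_at x : cdom (chart_at x) x.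
Proof. by case: atlasM => H _; exact: H. Qed.

Lemma cinvK a x : cdom a x -> cinv a (cmap a x) = x.
Proof. by case: atlasM => _ [H _]; exact: H. Qed.

Lemma open_cimg_cdom a b : open (cimg a (cdom b)).
Proof. by case: atlasM => _ [_ [H _]]; exact: H. Qed.

Lemma transition_smooth a b : smooth_on (cimg a (cdom b)) (cmap b \o cinv a).
Proof. by case: atlasM => _ [_ [_ H]]; exact: H. Qed.

Lemma cmap_inj a x y : cdom a x -> cdom a y -> cmap a x = cmap a y -> x = y.
Proof. by move=> ax ay E; rewrite -(cinvK ax) E cinvK. Qed.

Lemma cimg_cmap a U x : U x -> cdom a x -> cimg a U (cmap a x).
Proof. by move=> Ux ax; exists x. Qed.

Lemma cimg_cinv a U v : cimg a U v ->
  [/\ U (cinv a v), cdom a (cinv a v) & cmap a (cinv a v) = v].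
Proof. by case=> x [Ux ax] <-; rewrite cinvK. Qed.

Lemma cimg_cmapE a U x : cdom a x -> cimg a U (cmap a x) -> U x.
Proof. by move=> ax /cimg_cinv[]; rewrite cinvK. Qed.

Lemma cimgI a U V : cimg a (U `&` V) = cimg a U `&` cimg a V.
Proof.
apply/seteqP; split=> [v [x [[Ux Vx] ax] <-]|v].
  by split; exact: cimg_cmap.
move=> [/cimg_cinv[Ux ax E] /cimg_cinv[Vx _ _]].
by rewrite -E; apply: cimg_cmap.
Qed.

Lemma cimgT a : cimg a setT = cimg a (cdom a).
Proof.
apply/seteqP; split=> v [x [_ ax] <-]; exact: cimg_cmap.
Qed.

Lemma mopenI U V : mopen U -> mopen V -> mopen (U `&` V).
Proof. by move=> oU oV a; rewrite cimgI; exact: openI. Qed.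

Lemma mopen_cdom a : mopen (cdom a).
Proof. by move=> b; exact: open_cimg_cdom. Qed.

Lemma mopenT : mopen (setT : set M).
Proof. by move=> b; rewrite cimgT; exact: open_cimg_cdom. Qed.

Lemma mopen_cmap_preimage a (O : set 'rV[R]_n) : open O ->
  mopen [set x | cdom a x /\ O (cmap a x)].
Proof.
move=> oO b.
rewrite (_ : cimg b _ = cimg b (cdom a) `&` (cmap a \o cinv b) @^-1` O).
  rewrite openE => v [bav Ov]; apply: filterI.
    by apply: open_nbhs_nbhs; split=> //; exact: open_cimg_cdom.
  apply: (differentiable_continuous
    (smooth_differentiable (@transition_smooth b a) bav)).
  exact: open_nbhs_nbhs (conj oO Ov).
apply/seteqP; split=> [v [x [[ax Ox] bx] <-]|v].
  by split; [exact: cimg_cmap|rewrite /= cinvK].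
by move=> [/cimg_cinv[ax bx E] /= Ov]; rewrite -E; apply: cimg_cmap.
Qed.

(** Two points of the same chart domain are separated, as their images in
    R^n are. *)
Lemma chart_hausdorff a x y : cdom a x -> cdom a y -> x <> y ->
  exists U V, mopen U /\ mopen V /\ U x /\ V y /\ U `&` V = set0.
Proof.
move=> ax ay xy.
have /eqP nxy : cmap a x <> cmap a y by move/(cmap_inj ax ay).
have := @norm_hausdorff _ 'rV[R]_n; rewrite open_hausdorff.
move=> /(_ _ _ nxy) [[A B] /= [Ax By] [oA oB AB0]].
exists [set z | cdom a z /\ A (cmap a z)], [set z | cdom a z /\ B (cmap a z)].
split; first exact: mopen_cmap_preimage.
split; first exact: mopen_cmap_preimage.
split; first by split=> //; move: Ax; rewrite inE.
split; first by split=> //; move: By; rewrite inE.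
rewrite -subset0 => z [[_ Az] [_ Bz]].
have : (A `&` B) (cmap a z) by [].
by rewrite (eqP AB0).
Qed.

(** The cocycle rule for the differentials of the changes of coordinates. *)
Lemma dtransition_comp a b c x v : cdom a x -> cdom b x -> cdom c x ->
  'd (cmap c \o cinv b) (cmap b x) ('d (cmap b \o cinv a) (cmap a x) v) =
  'd (cmap c \o cinv a) (cmap a x) v.
Proof.
move=> ax bx cx.
have dab : differentiable (cmap b \o cinv a) (cmap a x).
  by apply: smooth_differentiable (@transition_smooth a b) _; exact: cimg_cmap.
have E : (cmap b \o cinv a) (cmap a x) = cmap b x by rewrite /= cinvK.
have dbc : differentiable (cmap c \o cinv b) ((cmap b \o cinv a) (cmap a x)).
  rewrite E.
  by apply: smooth_differentiable (@transition_smooth b c) _; exact: cimg_cmap.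
apply: etrans (diff_comp_at v E dab dbc) _; apply/esym.
apply: near_eq_diff_at; last exact: differentiable_comp.
have nx : nbhs (cmap a x) (cimg a (cdom b)).
  by apply: open_nbhs_nbhs; split; [exact: open_cimg_cdom|exact: cimg_cmap].
by apply: filterS nx => w /cimg_cinv[bw aw _]; rewrite /= cinvK.
Qed.

Lemma dtransition_id a x v : cdom a x ->
  'd (cmap a \o cinv a) (cmap a x) v = v.
Proof.
move=> ax; have daa := smooth_differentiable (@transition_smooth a a)
  (cimg_cmap ax ax).
rewrite (@near_eq_diff_at _ _ _ id) ?diff_id_at //.
have nx : nbhs (cmap a x) (cimg a (cdom a)).
  by apply: open_nbhs_nbhs; split; [exact: open_cimg_cdom|exact: cimg_cmap].
by apply: filterS nx => w /cimg_cinv[_ _ /= ->].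
Qed.

Lemma tcomp_tvec a b x v : cdom a x -> cdom b x ->
  tcomp b (tvec a x v) = 'd (cmap b \o cinv a) (cmap a x) v.
Proof.
by move=> ax bx; exact: dtransition_comp ax (cdom_chart_at x) bx.
Qed.

Lemma tvecK a x v : cdom a x -> tcomp a (tvec a x v) = v.
Proof. by move=> ax; rewrite tcomp_tvec // dtransition_id. Qed.

Lemma tcompK a x (X : tangent x) : cdom a x -> tvec a x (tcomp a X) = X.
Proof.
move=> ax; rewrite /tcomp /tvec dtransition_comp //; last exact: cdom_chart_at.
  by rewrite dtransition_id //; exact: cdom_chart_at.
exact: cdom_chart_at.
Qed.

Lemma tcomp_inj a x (X Y : tangent x) : cdom a x ->
  tcomp a X = tcomp a Y -> X = Y.
Proof. by move=> ax E; rewrite -(tcompK X ax) E tcompK. Qed.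

Lemma tcomp_chart_at x (X : tangent x) : tcomp (chart_at x) X = X.
Proof. by rewrite /tcomp dtransition_id //; exact: cdom_chart_at. Qed.

Lemma tcomp_trans a b x (X : tangent x) : cdom a x -> cdom b x ->
  tcomp b X = 'd (cmap b \o cinv a) (cmap a x) (tcomp a X).
Proof. by move=> ax bx; rewrite -tcomp_tvec // tcompK. Qed.

Lemma tcomp_partial a i x : cdom a x -> tcomp a (partial a i x) = delta_mx 0 i.
Proof. by move=> ax; rewrite /partial tvecK. Qed.

Lemma tvec_sum_partial a x v : tvec a x v = \sum_i v 0 i *: partial a i x.
Proof.
rewrite [X in tvec a x X = _]row_sum_delta.
by rewrite /tvec linear_sum; apply: eq_bigr => i _; rewrite linearZ.
Qed.

Lemma tangent_sum_partial a x (X : tangent x) : cdom a x ->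
  X = \sum_i tcomp a X 0 i *: partial a i x.
Proof. by move=> ax; rewrite -[LHS](tcompK X ax) tvec_sum_partial. Qed.

(** The partial derivatives of the transition map from [a] to [c], expressed
    in a third chart [b]. *)
Lemma dtransition_smooth_chart a b c (e : 'rV[R]_n) l :
  smooth_on (cimg b (cdom a `&` cdom c)) (fun v =>
    ('d (cmap c \o cinv a) (cmap a (cinv b v)) e) 0 l : R^o).
Proof.
have obac : open (cimg b (cdom a `&` cdom c)).
  by apply: mopenI; exact: mopen_cdom.
have oac := @open_cimg_cdom a c.
have sd := smooth_row_coord l oac (smooth_diff e oac (@transition_smooth a c)).
have st : smooth_on (cimg b (cdom a `&` cdom c)) (cmap a \o cinv b).
  by apply: smooth_sub (@transition_smooth b a); rewrite cimgI => v [].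
apply: smooth_ext obac _ (smooth_comp obac oac _ st sd) => // v /cimg_cinv.
by move=> [[av cv] bv _]; exact: cimg_cmap.
Qed.

Lemma dtransition_smooth a b (e : 'rV[R]_n) l :
  smooth_on (cimg a (cdom b)) (fun v =>
    ('d (cmap a \o cinv b) (cmap b (cinv a v)) e) 0 l : R^o).
Proof.
apply: smooth_sub (@dtransition_smooth_chart b a a e l) => v.
move=> /cimg_cinv[bv av E].
by rewrite -E; exact: cimg_cmap.
Qed.

End Atlas.

Arguments open_cimg_cdom {R n M} atlasM a b.
Arguments mopen_cdom {R n M} atlasM a.
Arguments mopenT {R n M} atlasM a.
Arguments transition_smooth {R n M} atlasM a b.
Arguments dtransition_smooth {R n M} atlasM a b e l.
Arguments dtransition_smooth_chart {R n M} atlasM a b c e l.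

(** * Countable bases *)

Section SecondCountable.
Variables (R : realType).

(** The balls with rational centre and radius 1/(m+1) form a basis of the
    topology of R^n. *)
Lemma rat_ball_basis n (O : set 'rV[R]_n) v : open O -> O v ->
  exists (q : 'rV[rat]_n) (m : nat),
    ball (map_mx ratr q : 'rV[R]_n) (m.+1%:R^-1) v /\
    ball (map_mx ratr q : 'rV[R]_n) (m.+1%:R^-1) `<=` O.
Proof.
move=> oO Ov; have /nbhs_ballP[e /= e0 eO] := open_nbhs_nbhs (conj oO Ov).
have e20 : 0 < e / 2 by rewrite divr_gt0.
have [m me] : exists m : nat, m.+1%:R^-1 < e / 2.
  exists (Num.truncn (e / 2)^-1).
  rewrite invf_plt ?posrE//; exact: truncnS_gt.
set d := m.+1%:R^-1 in me.
have d0 : 0 < d by rewrite invr_gt0.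
have /fin_all_exists[q qP] : forall i : 'I_n, exists r : rat,
    ratr r \in `]v 0 i - d, v 0 i + d[.
  by move=> i; apply: rat_in_itvoo; rewrite ltrD2l gtrN.
exists (\row_i q i), m; rewrite -/d.
have bv : ball (map_mx ratr (\row_i q i) : 'rV[R]_n) d v.
  split=> // i j; rewrite ord1 !mxE /ball /=.
  have := qP j; rewrite in_itv /= => /andP[h1 h2].
  by rewrite ltr_distlC; apply/andP; split; rewrite -?ltrBlDr // ltrBlDr.
split=> // w bw; apply: eO; apply: (@le_ball _ _ _ (d + d)).
  by rewrite (splitr e) lerD // ltW.
by apply: ball_triangle bw; apply: ball_sym.
Qed.

(** If countably many charts cover [M], the preimages of the rational balls
    in these charts form a countable basis. The sequence [c] is partial
    because there is no chart at all when [M] is empty. *)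
Lemma atlas_second_countable n (M : chartedSpace R n)
    (c : nat -> option (chart M)) : smooth_atlas M ->
  (forall x, exists k a, c k = Some a /\ cdom a x) ->
  exists B : nat -> set M, (forall k, mopen (B k)) /\
    forall U x, mopen U -> U x -> exists k, B k x /\ B k `<=` U.
Proof.
move=> atlasM cov.
pose D (a : chart M) (q : 'rV[rat]_n) (m : nat) : set M :=
  [set x | cdom a x /\ ball (map_mx ratr q : 'rV[R]_n) (m.+1%:R^-1) (cmap a x)].
pose B k : set M :=
  if @unpickle (nat * 'rV[rat]_n * nat)%type k is Some (j, q, m)
  then (if c j is Some a then D a q m else set0) else set0.
have o0 : mopen (set0 : set M).
  by move=> a; rewrite /cimg set0I image_set0; exact: open0.
exists B; split=> [k|U x oU Ux].
  rewrite /B; case: unpickle => // -[[j q] m]; case: (c j) => // a.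
  apply: mopen_cmap_preimage => //; exact: ball_open.
have [j [a [cja ax]]] := cov x.
have [q [m [bx bU]]] := rat_ball_basis (oU a) (cimg_cmap Ux ax).
exists (pickle (j, q, m)); rewrite /B pickleK cja; split; first by split.
by move=> y [ay /bU]; exact: cimg_cmapE.
Qed.

End SecondCountable.

(** * Components of tangent vectors and covectors *)

Section Fibre.
Variables (R : realType) (n : nat) (M : chartedSpace R n).
Hypothesis atlasM : smooth_atlas M.
Implicit Types (x : M) (a b c : chart M).

Lemma tcomp_linear a x : linear (@tcomp R n M a x).
Proof. by move=> k X Y; rewrite /tcomp linearP. Qed.

Lemma tcompD a x (X Y : tangent x) : tcomp a (X + Y) = tcomp a X + tcomp a Y.
Proof. by have := tcomp_linear a 1 X Y; rewrite !scale1r. Qed.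

Lemma tcomp0 a x : tcomp a (0 : tangent x) = 0.
Proof.
have := tcompD a (0 : tangent x) 0; rewrite addr0 => /eqP.
by rewrite -subr_eq subrr => /eqP.
Qed.

Lemma tcompZ a x k (X : tangent x) : tcomp a (k *: X) = k *: tcomp a X.
Proof. by have := tcomp_linear a k X 0; rewrite tcomp0 !addr0. Qed.

Lemma tcomp_sum a x (I : Type) (r : seq I) (P : pred I) (X : I -> tangent x) :
  tcomp a (\sum_(i <- r | P i) X i) = \sum_(i <- r | P i) tcomp a (X i).
Proof. exact: (big_morph _ (@tcompD a x) (@tcomp0 a x)). Qed.

Lemma cvecE a x y (X : tangent x) :
  (cvec a x y : 'Hom(tangent x, R^o)) X = \sum_i y 0 i * tcomp a X 0 i.
Proof.
rewrite /cvec linfunE_linear // => k Y Z.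
rewrite tcomp_linear scaler_sumr -big_split; apply: eq_bigr => i _ /=.
by rewrite !mxE mulrDr mulrCA.
Qed.

(** A covector is determined by its components: it is sum_i xi_i da^i. *)
Lemma covectorE a x (xi : cotangent x) (X : tangent x) : cdom a x ->
  (xi : 'Hom(tangent x, R^o)) X = \sum_i ccomp a xi i * tcomp a X 0 i.
Proof.
move=> ax; rewrite [X in _ X = _](tangent_sum_partial atlasM X ax).
rewrite linear_sum; apply: eq_bigr => i _.
by rewrite linearZ /= mulrC.
Qed.

Lemma ccomp_cvec a x y i : cdom a x -> ccomp a (cvec a x y) i = y 0 i.
Proof.
move=> ax; rewrite /ccomp cvecE (bigD1 i) //= tcomp_partial // mxE !eqxx mulr1.
by rewrite big1 ?addr0 // => j ji; rewrite mxE (negbTE ji) andbF mulr0.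
Qed.

Lemma ccompK a x (xi : cotangent x) : cdom a x ->
  cvec a x (\row_i ccomp a xi i) = xi.
Proof.
move=> ax; apply/lfunP => X; rewrite cvecE (covectorE _ _ ax).
by apply: eq_bigr => i _; rewrite mxE.
Qed.

Lemma ccomp_inj a x (xi eta : cotangent x) : cdom a x ->
  (forall i, ccomp a xi i = ccomp a eta i) -> xi = eta.
Proof.
move=> ax E; rewrite -(ccompK xi ax) -(ccompK eta ax); congr cvec.
by apply/rowP => i; rewrite !mxE.
Qed.

(** The components of a covector transform by the Jacobian matrix of the
    inverse change of coordinates. *)
Lemma ccomp_cvec_trans a b x y m : cdom a x -> cdom b x ->
  ccomp b (cvec a x y) m = \sum_l y 0 l *
    ('d (cmap a \o cinv b) (cmap b x) (delta_mx 0 m : 'rV[R]_n)) 0 l.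
Proof.
move=> ax bx; rewrite /ccomp cvecE; apply: eq_bigr => l _.
by rewrite /partial tcomp_tvec.
Qed.

End Fibre.

(** * The cotangent bundle is a smooth manifold *)

Section CotangentBundle.
Variables (R : realType) (n : nat) (M : chartedSpace R n).
Hypothesis atlasM : smooth_atlas M.
Local Notation TsM := (cotangent_bundle M).

(** [cvec] is the inverse of [ccomp] in the total space; the base point is
    only equal to [x] up to a provable equality. *)
Lemma Tagged_cvec (a : chart M) (x x' : M) (xi : cotangent x) :
  cdom a x -> x' = x ->
  Tagged (@cotangent R n M) (cvec a x' (\row_i ccomp a xi i)) =
  Tagged (@cotangent R n M) xi.
Proof. by move=> ax ->; rewrite ccompK. Qed.

Lemma cmap_cotangent_cinv (a : chart M) (w : 'rV[R]_(n + n)) :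
  cdom a (cinv a (lsubmx w)) -> cmap a (cinv a (lsubmx w)) = lsubmx w ->
  @cmap R (n + n) TsM a (@cinv R (n + n) TsM a w) = w.
Proof.
move=> aw E; rewrite /= E -[RHS]hsubmxK; congr row_mx.
by apply/rowP => i; rewrite !mxE ccomp_cvec // mxE.
Qed.

(** The chart [a] of T*M maps the part of T*M above [U] onto the product of
    the image of [U] and R^n. *)
Lemma cimg_cotangent (a : chart M) (U : set M) :
  @cimg R (n + n) TsM a [set p | U (tag p)] = lsubmx @^-1` (cimg a U).
Proof.
apply/seteqP; split=> [w [p [Up ap] <-]|w /= /(cimg_cinv atlasM)[Uw aw E]].
  by rewrite /= row_mxKl; exact: cimg_cmap.
exists (@cinv R (n + n) TsM a w); last exact: cmap_cotangent_cinv.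
by split.
Qed.

Lemma cimg_cotangent_cdom (a b : chart M) :
  @cimg R (n + n) TsM a (@cdom R (n + n) TsM b) =
  lsubmx @^-1` (cimg a (cdom b)).
Proof. exact: cimg_cotangent. Qed.

Lemma open_lsubmx_preimage (O : set 'rV[R]_n) : open O ->
  open ((lsubmx : 'rV[R]_(n + n) -> 'rV[R]_n) @^-1` O).
Proof. by apply: open_comp => w _; exact: continuous_lsubmx. Qed.

Lemma smooth_lsubmx (O : set 'rV[R]_(n + n)) : open O ->
  smooth_on O (lsubmx : 'rV[R]_(n + n) -> 'rV[R]_n).
Proof.
move=> oO; apply: smooth_row => // j.
apply: smooth_ext (@smooth_coord R (n + n) O (lshift n j)) => // w _.
by rewrite mxE.
Qed.

(** Functions of the base coordinates, seen on T*M. *)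
Lemma smooth_comp_lsubmx (O : set 'rV[R]_n) (f : 'rV[R]_n -> R^o) : open O ->
  smooth_on O f ->
  smooth_on (lsubmx @^-1` O : set 'rV[R]_(n + n)) (f \o lsubmx).
Proof.
move=> oO sf; have oO' := open_lsubmx_preimage oO.
by apply: smooth_comp sf => //; exact: smooth_lsubmx.
Qed.

(** In the coordinates (x, y), the base components of a transition map are
    those of [M], and its fibre components are sum_l y_l P_lm(x), with P the
    Jacobian matrix of the inverse transition. *)
Lemma cotangent_atlas : smooth_atlas TsM.
Proof.
split; first by move=> p; exact: (cdom_chart_at atlasM (tag p)).
split.
  move=> a [x xi] /= ax; rewrite row_mxKl row_mxKr.
  by apply: Tagged_cvec => //; exact: cinvK.
have oc (a b : chart M) : open (@cimg R (n + n) TsM a (@cdom _ _ TsM b)).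
  rewrite cimg_cotangent_cdom.
  exact/open_lsubmx_preimage/open_cimg_cdom.
split=> //.
have sT (a b : chart M) : smooth_on (@cimg R (n + n) TsM a (@cdom _ _ TsM b))
  (@cmap R (n + n) TsM b \o @cinv R (n + n) TsM a); last first.
  by move=> a b; exact: sT.
have oab := open_cimg_cdom atlasM a b.
apply: smooth_row => // j; rewrite cimg_cotangent_cdom.
have oE := open_lsubmx_preimage oab.
have st := transition_smooth atlasM a b.
case: (split_ordP j) => [i ->|m ->].
  apply: smooth_ext (smooth_comp_lsubmx oab (smooth_row_coord i oab st)) => //.
  by move=> w _ /=; rewrite row_mxEl.
have oba := open_cimg_cdom atlasM b a.
have sP l := smooth_comp_lsubmx oab
  (dtransition_smooth atlasM a b (delta_mx 0 m : 'rV[R]_n) l).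
have H : smooth_on (lsubmx @^-1` (cimg a (cdom b))) (fun w : 'rV[R]_(n + n) =>
   \sum_l w 0 (rshift n l) * ('d (cmap a \o cinv b)
     (cmap b (cinv a (lsubmx w))) (delta_mx 0 m : 'rV[R]_n)) 0 l : R^o).
  apply: smooth_sum => // l _; apply: smoothM => //; first exact: smooth_coord.
  exact: smooth_ext oE _ (sP l).
apply: smooth_ext H => // w /= /(cimg_cinv atlasM)[bw aw _].
rewrite row_mxEr mxE ccomp_cvec_trans //; apply: eq_bigr => l _.
by rewrite mxE.
Qed.

(** Points over distinct base points are separated by [M], points of the
    same fibre by a chart. Countably many chart domains cover [M], since its
    basic open sets that lie in some chart domain do. *)
Lemma cotangent_manifold : smooth_manifold M -> smooth_manifold TsM.
Proof.
move=> [_ [_ [_ [_ [hausM [B [oB baseM]]]]]]].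
have [c1 [c2 [c3 c4]]] := cotangent_atlas.
split; first exact: c1.
split; first exact: c2.
split; first exact: c3.
split; first exact: c4.
split.
  move=> [x xi] [y eta] neq; have [E|xy] := pselect (x = y).
    apply: (chart_hausdorff cotangent_atlas) neq.
      exact: (cdom_chart_at atlasM x).
    by rewrite /= -E; exact: (cdom_chart_at atlasM x).
  have [U [V [oU [oV [Ux [Vy UV]]]]]] := hausM _ _ xy.
  exists [set p | U (tag p)], [set p | V (tag p)].
  do ![split=> //].
  - by move=> a; rewrite cimg_cotangent; exact/open_lsubmx_preimage/oU.
  - by move=> a; rewrite cimg_cotangent; exact/open_lsubmx_preimage/oV.
  rewrite -subset0 => -[z zeta] [/= Uz Vz].
  by have : (U `&` V) z by []; rewrite UV.
(* A chart whose domain contains the k-th basic open set, if there is one. *)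
pose c k : option (chart M) :=
  if pselect (exists a, B k `<=` cdom a) is left e then Some (projT1 (cid e))
  else None.
apply: (atlas_second_countable (M := TsM) (c := c) cotangent_atlas) => p.
have [k [Bp kx]] := baseM _ _ (mopen_cdom atlasM (chart_at (tag p)))
  (cdom_chart_at atlasM (tag p)).
exists k; rewrite /c; case: pselect => [e|[]]; last first.
  by exists (chart_at (tag p)).
by exists (projT1 (cid e)); split=> //=; case: (cid e) => a /= /(_ _ Bp).
Qed.

End CotangentBundle.

(** * Linear connections under a change of chart *)

Section Connection.
Variables (R : realType) (n : nat) (M : chartedSpace R n).
Hypothesis atlasM : smooth_atlas M.
Variable nabla : vfield M -> vfield M -> vfield M.
Hypothesis nablaP : linear_connection nabla.
Implicit Types (x : M) (a b c : chart M) (U : set M).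

(** Smoothness of a vector field may be checked on components. *)
Lemma smooth_vfieldW U (X : vfield M) : mopen U ->
  (forall b l, smooth_on (cimg b U)
     (fun v => tcomp b (X (cinv b v)) 0 l : R^o)) ->
  smooth_vfield U X.
Proof. by move=> oU sX b; apply: smooth_row => //; exact: oU. Qed.

Lemma smooth_vfield_coord U (X : vfield M) b l : mopen U -> smooth_vfield U X ->
  smooth_on (cimg b U) (fun v => tcomp b (X (cinv b v)) 0 l : R^o).
Proof. by move=> oU sX; exact: smooth_row_coord (oU b) (sX b). Qed.

Lemma smooth_vfield0 U : mopen U -> smooth_vfield U (fun x => 0 : tangent x).
Proof.
move=> oU; apply: smooth_vfieldW => // b l.
apply: smooth_ext (oU b) _ (smooth_cst _ (0 : R^o)) => v _.
by rewrite tcomp0 mxE.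
Qed.

Lemma smooth_vfieldD U (X Y : vfield M) : mopen U ->
  smooth_vfield U X -> smooth_vfield U Y ->
  smooth_vfield U (fun x => X x + Y x).
Proof.
move=> oU sX sY; apply: smooth_vfieldW => // b l.
have H := smoothD (oU b) (smooth_vfield_coord b l oU sX)
  (smooth_vfield_coord b l oU sY).
by apply: smooth_ext (oU b) _ H => v _; rewrite tcompD mxE.
Qed.

Lemma smooth_vfieldZ U (f : M -> R) (X : vfield M) : mopen U ->
  smooth_fun U f -> smooth_vfield U X -> smooth_vfield U (fun x => f x *: X x).
Proof.
move=> oU sf sX; apply: smooth_vfieldW => // b l.
have H := smoothM (oU b) (sf b) (smooth_vfield_coord b l oU sX).
by apply: smooth_ext (oU b) _ H => v _; rewrite tcompZ mxE.
Qed.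

(** The components in the chart [c] of the coordinate fields of [a]. *)
Lemma smooth_fun_tcomp_partial a c i l :
  smooth_fun (cdom a `&` cdom c) (fun x => tcomp c (partial a i x) 0 l).
Proof.
move=> b.
have ob : open (cimg b (cdom a `&` cdom c)).
  by apply: mopenI => //; exact: mopen_cdom.
apply: smooth_ext ob _ (dtransition_smooth_chart atlasM a b c (delta_mx 0 i) l).
by move=> v /(cimg_cinv atlasM)[[av cv] bv _]; rewrite /= /partial tcomp_tvec.
Qed.

Lemma smooth_vfield_partial a U i : mopen U -> U `<=` cdom a ->
  smooth_vfield U (fun x => partial a i x).
Proof.
move=> oU Ua; apply: smooth_vfieldW => // b l.
have := smooth_fun_tcomp_partial a b i l b; apply: smooth_sub => v.
move=> /(cimg_cinv atlasM)[Uv bv E]; rewrite -E; apply: cimg_cmap => //.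
by split=> //; exact: Ua.
Qed.

Lemma smooth_fun_cst U r : smooth_fun U (fun=> r).
Proof. by move=> b; exact: (smooth_cst _ (r : R^o)). Qed.

Section Open.
Variable U : set M.
Hypothesis oU : mopen U.

Lemma nabla_local (X X' Y Y' : vfield M) :
  smooth_vfield U X -> smooth_vfield U X' ->
  smooth_vfield U Y -> smooth_vfield U Y' ->
  (forall x, U x -> X x = X' x) -> (forall x, U x -> Y x = Y' x) ->
  forall x, U x -> nabla X Y x = nabla X' Y' x.
Proof.
move=> sX sX' sY sY' XX' YY' x Ux.
by have [H _ _ _ _] := nablaP oU sX sX' sY sY' (@smooth_fun_cst U 0); exact: H.
Qed.

Lemma nabla_smooth (X Y : vfield M) : smooth_vfield U X -> smooth_vfield U Y ->
  smooth_vfield U (nabla X Y).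
Proof.
move=> sX sY.
by have [_ H _ _ _] := nablaP oU sX sX sY sY (@smooth_fun_cst U 0).
Qed.

(** Tensoriality of [nabla] in its first argument, for finite combinations
    with smooth coefficients. *)
Lemma nabla_sum_l (Y : vfield M) m (f : 'I_m -> M -> R)
    (X : 'I_m -> vfield M) x :
  smooth_vfield U Y -> (forall i, smooth_fun U (f i)) ->
  (forall i, smooth_vfield U (X i)) -> U x ->
  nabla (fun z => \sum_i f i z *: X i z) Y x = \sum_i f i x *: nabla (X i) Y x.
Proof.
move=> sY sf sX Ux.
suff H : forall r : seq 'I_m,
    nabla (fun z => \sum_(i <- r) f i z *: X i z) Y x =
      \sum_(i <- r) f i x *: nabla (X i) Y x /\
    smooth_vfield U (fun z => \sum_(i <- r) f i z *: X i z).
  by have [] := H (index_enum 'I_m).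
elim=> [|i r [IH sr]].
  have s0 := smooth_vfield0 oU.
  have E0 : (fun z => \sum_(i <- [::]) f i z *: X i z) =
      (fun z => 0 : tangent z).
    by apply: functional_extensionality_dep => z; rewrite big_nil.
  rewrite E0 big_nil; split=> //.
  (* nabla_0 Y = 0 follows from nabla_(1 0 + 0) Y = nabla_0 Y + nabla_0 Y. *)
  have [_ _ H _ _] := nablaP oU s0 s0 sY sY (@smooth_fun_cst U 1).
  have := H x Ux.
  have -> : (fun z : M => 1 *: (0 : tangent z) + 0) = (fun z => 0 : tangent z).
    by apply: functional_extensionality_dep => z; rewrite scaler0 addr0.
  by rewrite scale1r -{1}[X in X = _]addr0 => /addrI.
have Ei : (fun z => \sum_(j <- i :: r) f j z *: X j z) =
    (fun z => f i z *: X i z + \sum_(j <- r) f j z *: X j z).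
  by apply: functional_extensionality_dep => z; rewrite big_cons.
rewrite Ei big_cons; split.
  have [_ _ H _ _] := nablaP oU (sX i) sr sY sY (sf i).
  by rewrite H // IH.
by apply: smooth_vfieldD => //; exact: smooth_vfieldZ.
Qed.

(** The Leibniz rule for finite combinations with smooth coefficients. *)
Lemma nabla_sum_r (X : vfield M) m (f : 'I_m -> M -> R)
    (Y : 'I_m -> vfield M) x :
  smooth_vfield U X -> (forall i, smooth_fun U (f i)) ->
  (forall i, smooth_vfield U (Y i)) -> U x ->
  nabla X (fun z => \sum_i f i z *: Y i z) x =
    \sum_i (tderiv (X x) (f i) *: Y i x + f i x *: nabla X (Y i) x).
Proof.
move=> sX sf sY Ux.
suff H : forall r : seq 'I_m,
    nabla X (fun z => \sum_(i <- r) f i z *: Y i z) x =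
      \sum_(i <- r) (tderiv (X x) (f i) *: Y i x + f i x *: nabla X (Y i) x) /\
    smooth_vfield U (fun z => \sum_(i <- r) f i z *: Y i z).
  by have [] := H (index_enum 'I_m).
elim=> [|i r [IH sr]].
  have s0 := smooth_vfield0 oU.
  have E0 : (fun z => \sum_(i <- [::]) f i z *: Y i z) =
      (fun z => 0 : tangent z).
    by apply: functional_extensionality_dep => z; rewrite big_nil.
  rewrite E0 big_nil; split=> //.
  have [_ _ _ H _] := nablaP oU sX sX s0 s0 (@smooth_fun_cst U 1).
  have := H x Ux.
  have -> : (fun z : M => (0 : tangent z) + 0) = (fun z => 0 : tangent z).
    by apply: functional_extensionality_dep => z; rewrite addr0.
  by rewrite -{1}[X in X = _]addr0 => /addrI.
have Ei : (fun z => \sum_(j <- i :: r) f j z *: Y j z) =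
    (fun z => f i z *: Y i z + \sum_(j <- r) f j z *: Y j z).
  by apply: functional_extensionality_dep => z; rewrite big_cons.
have sfY : smooth_vfield U (fun z => f i z *: Y i z) by exact: smooth_vfieldZ.
rewrite Ei big_cons; split; last exact: smooth_vfieldD.
have [_ _ _ H _] := nablaP oU sX sX sfY sr (sf i).
have [_ _ _ _ L] := nablaP oU sX sX (sY i) sr (sf i).
by rewrite H // IH L.
Qed.

End Open.

(** The value of sum_i X_i nabla_(d/dc^i) Y at a point is independent of the
    chart in which the components of X are taken. *)
Lemma nabla_partial_change_l a c x (X : tangent x) (Y : vfield M) :
  cdom a x -> cdom c x -> smooth_vfield (cdom a `&` cdom c) Y ->
  \sum_i tcomp c X 0 i *: nabla (fun z => partial c i z) Y x =
  \sum_i tcomp a X 0 i *: nabla (fun z => partial a i z) Y x.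
Proof.
move=> ax cx sY; have oU : mopen (cdom a `&` cdom c).
  by apply: mopenI => //; exact: mopen_cdom.
have sa i : smooth_vfield (cdom a `&` cdom c) (fun z => partial a i z).
  by apply: smooth_vfield_partial => // z [].
have sc i : smooth_vfield (cdom a `&` cdom c) (fun z => partial c i z).
  by apply: smooth_vfield_partial => // z [].
(* d/dc^i = sum_k f_ik d/da^k on the common domain. *)
pose f i k z := tcomp a (partial c i z) 0 k.
have sf i k : smooth_fun (cdom a `&` cdom c) (f i k).
  by rewrite setIC; exact: smooth_fun_tcomp_partial.
have sS i : smooth_vfield (cdom a `&` cdom c)
    (fun z => \sum_k f i k z *: partial a k z).
  apply: smooth_vfieldW => // b l.
  apply: smooth_ext (oU b) _ (smooth_vfield_coord b l oU (sc i)) => v.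
  move=> /(cimg_cinv atlasM)[[av cv] _ _].
  by rewrite {1}(tangent_sum_partial atlasM (partial c i _) av).
have E i : nabla (fun z => partial c i z) Y x =
    \sum_k f i k x *: nabla (fun z => partial a k z) Y x.
  apply: etrans _ (nabla_sum_l oU sY (sf i) sa (conj ax cx)).
  apply: (nabla_local oU) => // z [az cz].
  exact: (tangent_sum_partial atlasM).
transitivity (\sum_i \sum_k (tcomp c X 0 i * f i k x) *:
    nabla (fun z => partial a k z) Y x).
  apply: eq_bigr => i _; apply: etrans (congr1 (GRing.scale _) (E i)) _.
  rewrite scaler_sumr; apply: eq_bigr => k _.
  by rewrite scalerA.
rewrite exchange_big; apply: eq_bigr => k _ /=.
rewrite -scaler_suml; congr (_ *: _).
rewrite [in RHS](tangent_sum_partial atlasM X cx) tcomp_sum summxE.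
by apply: eq_bigr => i _; rewrite tcompZ mxE.
Qed.

(** The derivative of d/da^m = sum_l P_lm d/dc^l along d/dc^i. *)
Lemma nabla_partial_change_r a c i m x : cdom a x -> cdom c x ->
  nabla (fun z => partial c i z) (fun z => partial a m z) x =
  \sum_l (tderiv (partial c i x) (fun z => tcomp c (partial a m z) 0 l)
            *: partial c l x
          + tcomp c (partial a m x) 0 l *:
            nabla (fun z => partial c i z) (fun z => partial c l z) x).
Proof.
move=> ax cx; have oU : mopen (cdom a `&` cdom c).
  by apply: mopenI => //; exact: mopen_cdom.
have sa k : smooth_vfield (cdom a `&` cdom c) (fun z => partial a k z).
  by apply: smooth_vfield_partial => // z [].
have sc k : smooth_vfield (cdom a `&` cdom c) (fun z => partial c k z).
  by apply: smooth_vfield_partial => // z [].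
have sf l : smooth_fun (cdom a `&` cdom c)
    (fun z => tcomp c (partial a m z) 0 l).
  exact: smooth_fun_tcomp_partial.
rewrite -(nabla_sum_r oU (sc i) sf sc) //.
have E z : (cdom a `&` cdom c) z ->
    partial a m z = \sum_l tcomp c (partial a m z) 0 l *: partial c l z.
  by move=> [az cz]; exact: (tangent_sum_partial atlasM).
apply: (nabla_local oU) => //.
apply: smooth_vfieldW => // b l.
apply: smooth_ext (oU b) _ (smooth_vfield_coord b l oU (sa m)) => v.
by move=> /(cimg_cinv atlasM)[acv _ _]; rewrite {1}E.
Qed.

End Connection.

(** * The differential of the transition maps of the cotangent bundle *)

Section CotangentTransition.
Variables (R : realType) (n : nat) (M : chartedSpace R n).
Hypothesis atlasM : smooth_atlas M.
Local Notation TsM := (cotangent_bundle M).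
Implicit Types (a c : chart M) (p : TsM).

Let T c a := @cmap R (n + n) TsM a \o @cinv R (n + n) TsM c.

Lemma cotangent_transition_differentiable a c p :
  cdom a (base p) -> cdom c (base p) ->
  differentiable (T c a) (@cmap R (n + n) TsM c p).
Proof.
move=> ap cp.
apply: (smooth_differentiable (transition_smooth (cotangent_atlas atlasM) c a)).
exact: (@cimg_cmap R (n + n) TsM c (@cdom R (n + n) TsM a) p).
Qed.

(** Near [p], the coordinates of [c] describe points in the domain of [a]. *)
Lemma cotangent_near a c p : cdom a (base p) -> cdom c (base p) ->
  \forall w \near (@cmap R (n + n) TsM c p), cimg c (cdom a) (lsubmx w).
Proof.
move=> ap cp.
have oU := open_lsubmx_preimage (open_cimg_cdom atlasM c a).
apply: (@open_nbhs_nbhs _ (@cmap R (n + n) TsM c p)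
  (lsubmx @^-1` cimg c (cdom a) : set 'rV[R]_(n + n))); split=> //.
by rewrite /= row_mxKl; exact: cimg_cmap.
Qed.

Lemma dcotangent_transition_l a c p v i :
  cdom a (base p) -> cdom c (base p) ->
  ('d (T c a) (@cmap R (n + n) TsM c p) v) 0 (lshift n i) =
  ('d (cmap a \o cinv c) (cmap c (base p)) (lsubmx v)) 0 i.
Proof.
move=> ap cp; have dT := cotangent_transition_differentiable ap cp.
rewrite -(deriveE v dT) -(derive_row_coord v _ dT).
have dt : differentiable (cmap a \o cinv c) (cmap c (base p)).
  apply: (smooth_differentiable (transition_smooth atlasM c a)).
  exact: cimg_cmap.
rewrite -(deriveE _ dt) -(derive_row_coord _ _ dt).
have E : (fun y => T c a y 0 (lshift n i) : R^o) =
    (fun y => ((cmap a \o cinv c) (lsubmx y)) 0 i).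
  by apply/funext => y; rewrite /= row_mxEl.
rewrite E (derive_lsubmx (fun y => (cmap a \o cinv c) y 0 i : R^o)).
by rewrite /= row_mxKl.
Qed.

(** The fibre components sum_l y_l P_lm(x) of the transition map are
    differentiated by the product rule, P_lm being the components in the
    chart [c] of the field d/da^m. *)
Lemma dcotangent_transition_r a c p v m :
  cdom a (base p) -> cdom c (base p) ->
  ('d (T c a) (@cmap R (n + n) TsM c p) v) 0 (rshift n m) =
  \sum_l (rsubmx v 0 l * tcomp c (partial a m (base p)) 0 l
   + ccomp c (tagged p) l *
     'd (fun z => tcomp c (partial a m (cinv c z)) 0 l : R^o)
       (cmap c (base p)) (lsubmx v)).
Proof.
move=> ap cp; have dT := cotangent_transition_differentiable ap cp.
rewrite -(deriveE v dT) -(derive_row_coord v _ dT).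
pose Q l (z : 'rV[R]_n) := tcomp c (partial a m (cinv c z)) 0 l : R^o.
have dQ l : differentiable (Q l) (cmap c (base p)).
  apply: (smooth_differentiable (@smooth_fun_tcomp_partial _ _ _ atlasM
    a c m l c)).
  exact: cimg_cmap.
have dQ' l : differentiable (fun w : 'rV[R]_(n + n) => Q l (lsubmx w))
    (@cmap R (n + n) TsM c p).
  apply: (@differentiable_comp _ _ _ _ lsubmx (Q l)).
    exact: differentiable_lsubmx.
  by rewrite /= row_mxKl; exact: dQ.
have E : 'D_v (fun y => T c a y 0 (rshift n m) : R^o)
      (@cmap R (n + n) TsM c p) =
    'D_v (fun w : 'rV[R]_(n + n) =>
      \sum_l w 0 (rshift n l) * Q l (lsubmx w) : R^o)
      (@cmap R (n + n) TsM c p).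
  apply: near_eq_derive; apply: filterS (cotangent_near ap cp) => w.
  move=> /(cimg_cinv atlasM)[aw cw _].
  rewrite /= row_mxEr mxE ccomp_cvec_trans //; apply: eq_bigr => l _.
  by rewrite mxE /Q /partial tcomp_tvec.
rewrite E (derive_sum_mul v
  (f := fun l (w : 'rV[R]_(n + n)) => w 0 (rshift n l))) //; last first.
  by move=> l; exact: differentiable_coord.
apply: eq_bigr => l _.
have h1 : 'D_v (fun w : 'rV[R]_(n + n) => w 0 (rshift n l) : R^o)
    (@cmap R (n + n) TsM c p) = rsubmx v 0 l.
  by rewrite derive_coord mxE.
have h2 : Q l (lsubmx (@cmap R (n + n) TsM c p)) =
    tcomp c (partial a m (base p)) 0 l.
  by rewrite /Q /= row_mxKl cinvK.
have h3 : @cmap R (n + n) TsM c p 0 (rshift n l) = ccomp c (tagged p) l.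
  by rewrite /= row_mxEr mxE.
have h4 : 'D_v (fun y : 'rV[R]_(n + n) => Q l (lsubmx y))
    (@cmap R (n + n) TsM c p) = 'd (Q l) (cmap c (base p)) (lsubmx v).
  by rewrite (derive_lsubmx (Q l)) [lsubmx (cmap _ _)]/= row_mxKl deriveE.
exact: (f_equal2 _ (f_equal2 _ h1 h2) (f_equal2 _ h3 h4)).
Qed.

End CotangentTransition.

(** * The map Phi in an arbitrary chart *)

Section PhiCoordinates.
Variables (R : realType) (n : nat) (M : chartedSpace R n).
Variable nabla : vfield M -> vfield M -> vfield M.
Local Notation TsM := (cotangent_bundle M).
Implicit Types (a c : chart M) (p : TsM).

(** The coefficients N_il = sum_k y_k Gamma^k_il of the horizontal lift at
    [p], in the chart [a]. *)
Definition hcoef a p (i l : 'I_n) : R :=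
  \sum_k ccomp a (tagged p) k * christoffel nabla a (base p) k i l.

(** The expression of Phi in the chart [a]. *)
Definition Phi_coord a p (X eta : 'rV[R]_n) : 'rV[R]_(n + n) :=
  row_mx X (\row_l (\sum_i X 0 i * hcoef a p i l + eta 0 l)).

Lemma Phi_chartE a p u :
  Phi_chart nabla a u =
  @tvec R (n + n) TsM a p
    (Phi_coord a p (tcomp a u.1) (\row_l ccomp a u.2 l)).
Proof.
rewrite tvec_sum_partial big_split_ord /= /Phi_chart /hlift.
transitivity (\sum_i (tcomp a u.1 0 i *:
      @partial R (n + n) TsM a (lshift n i) p +
    tcomp a u.1 0 i *: \sum_l hcoef a p i l *:
      @partial R (n + n) TsM a (rshift n l) p) +
    \sum_j ccomp a u.2 j *: @partial R (n + n) TsM a (rshift n j) p).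
  congr (_ + _); apply: eq_bigr => i _; rewrite scalerDr; congr (_ + _ *: _).
  by rewrite exchange_big; apply: eq_bigr => l _; rewrite -scaler_suml.
rewrite big_split /= -addrA; congr (_ + _).
  by apply: eq_bigr => i _; rewrite row_mxEl.
transitivity (\sum_l (\sum_i tcomp a u.1 0 i * hcoef a p i l + ccomp a u.2 l)
    *: @partial R (n + n) TsM a (rshift n l) p); last first.
  by apply: eq_bigr => l _; rewrite row_mxEr !mxE.
under [RHS]eq_bigr do rewrite scalerDl scaler_suml.
rewrite big_split /= exchange_big /=; congr (_ + _); apply: eq_bigr => i _.
by rewrite scaler_sumr; apply: eq_bigr => l _; rewrite scalerA.
Qed.

End PhiCoordinates.

Section PhiChart.
Variables (R : realType) (n : nat) (M : chartedSpace R n).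
Hypothesis atlasM : smooth_atlas M.
Variable nabla : vfield M -> vfield M -> vfield M.
Hypothesis nablaP : linear_connection nabla.
Local Notation TsM := (cotangent_bundle M).
Implicit Types (a c : chart M) (p : TsM).

(** A covector seen as a linear form, so that it can be applied to tangent
    vectors. *)
Definition covec x (xi : cotangent x) : 'Hom(@tangent R n M x, R^o) := xi.

(** N_il = xi(nabla_(d/da^i) d/da^l) at the point [p] = (x, xi). *)
Lemma hcoefE a p i l : cdom a (base p) ->
  hcoef nabla a p i l =
  covec (tagged p) (nabla (fun z => partial a i z) (fun z => partial a l z)
    (base p)).
Proof. by move=> ap; rewrite /covec (covectorE atlasM _ _ ap). Qed.

Lemma tderiv_sum c x (X : tangent x) f : cdom c x ->
  tderiv X f = \sum_i tcomp c X 0 i * tderiv (partial c i x) f.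
Proof.
move=> cx; rewrite [X in tderiv X f = _](tangent_sum_partial atlasM X cx).
rewrite /tderiv linear_sum; apply: eq_bigr => i _.
by rewrite linearZ.
Qed.

(** The transformation rule of the coefficients of the horizontal lift, the
    analogue of that of the Christoffel symbols. *)
Lemma hcoef_change a c p (X : tangent (base p)) m :
  cdom a (base p) -> cdom c (base p) ->
  \sum_j tcomp a X 0 j * hcoef nabla a p j m =
  \sum_l ((\sum_i tcomp c X 0 i * hcoef nabla c p i l)
            * tcomp c (partial a m (base p)) 0 l
          + ccomp c (tagged p) l *
            tderiv X (fun z => tcomp c (partial a m z) 0 l)).
Proof.
move=> ap cp; set xi := covec (tagged p).
have sY : smooth_vfield (cdom a `&` cdom c) (fun z => partial a m z).
  apply: smooth_vfield_partial => [//||z []//].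
  by apply: mopenI => //; exact: mopen_cdom.
transitivity (xi (\sum_j tcomp a X 0 j *:
    nabla (fun z => partial a j z) (fun z => partial a m z) (base p))).
  rewrite linear_sum; apply: eq_bigr => j _.
  by rewrite linearZ hcoefE.
rewrite -(nabla_partial_change_l atlasM nablaP X ap cp sY).
transitivity (\sum_i tcomp c X 0 i * \sum_l
   (tderiv (partial c i (base p)) (fun z => tcomp c (partial a m z) 0 l)
     * ccomp c (tagged p) l +
    tcomp c (partial a m (base p)) 0 l * hcoef nabla c p i l)).
  rewrite linear_sum; apply: eq_bigr => i _.
  rewrite linearZ (nabla_partial_change_r atlasM nablaP i m ap cp) linear_sum.
  congr (_ * _); apply: eq_bigr => l _.
  by rewrite linearD !linearZ hcoefE.
under eq_bigr do rewrite mulr_sumr; rewrite exchange_big.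
apply: eq_bigr => l _ /=.
under eq_bigr do rewrite mulrDr; rewrite big_split /= addrC; congr (_ + _).
  by rewrite mulr_suml; apply: eq_bigr => i _; rewrite mulrCA mulrC.
rewrite (tderiv_sum X _ cp) mulr_sumr; apply: eq_bigr => i _.
by rewrite mulrA mulrC.
Qed.

Lemma Phi_coord_linear a p k (X X' eta eta' : 'rV[R]_n) :
  Phi_coord nabla a p (k *: X + X') (k *: eta + eta') =
  k *: Phi_coord nabla a p X eta + Phi_coord nabla a p X' eta'.
Proof.
rewrite scale_row_mx add_row_mx; congr row_mx; apply/rowP => l; rewrite !mxE.
rewrite mulrDr mulr_sumr addrACA -big_split; congr (_ + _).
by apply: eq_bigr => i _; rewrite !mxE mulrDl mulrA.
Qed.

Lemma Phi_coord_lsubmx a p (X eta : 'rV[R]_n) :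
  lsubmx (Phi_coord nabla a p X eta) = X.
Proof. exact: row_mxKl. Qed.

Lemma Phi_coord_lshift a p (X eta : 'rV[R]_n) i :
  Phi_coord nabla a p X eta 0 (lshift n i) = X 0 i.
Proof. exact: row_mxEl. Qed.

Lemma Phi_coord_rshift a p (X eta : 'rV[R]_n) l :
  Phi_coord nabla a p X eta 0 (rshift n l) =
  \sum_i X 0 i * hcoef nabla a p i l + eta 0 l.
Proof. by rewrite row_mxEr mxE. Qed.

Lemma Phi_chart_linear a p : linear (Phi_chart nabla a (p := p)).
Proof.
move=> k u v; rewrite !Phi_chartE tcomp_linear.
have -> : \row_l ccomp a (k *: u + v).2 l =
    k *: (\row_l ccomp a u.2 l) + \row_l ccomp a v.2 l.
  by apply/rowP => l; rewrite !mxE /ccomp add_lfunE scale_lfunE.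
by rewrite Phi_coord_linear /tvec linearP.
Qed.

Lemma PhiE p u : Phi nabla p u = Phi_chart nabla (chart_at (base p)) u.
Proof. by rewrite /Phi linfunE_linear //; exact: Phi_chart_linear. Qed.

(** Phi, which is defined by means of the chart [chart_at (base p)], has
    the expected components in any chart [a] around the base point of [p]. *)
Lemma tcomp_Phi a p (u : bigtangent (base p)) : cdom a (base p) ->
  @tcomp R (n + n) TsM a p (Phi nabla p u) =
  Phi_coord nabla a p (tcomp a u.1) (\row_l ccomp a u.2 l).
Proof.
move=> ap; rewrite PhiE Phi_chartE; set c := chart_at (base p).
have cp : cdom c (base p) by exact: cdom_chart_at.
rewrite (tcomp_tvec (cotangent_atlas atlasM)) //.
apply/rowP => j; case: (split_ordP j) => [i ->|m ->].
  apply: etrans (dcotangent_transition_l atlasM _ i ap cp) _.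
  by rewrite Phi_coord_lsubmx Phi_coord_lshift -(tcomp_trans atlasM _ cp ap).
apply: etrans (dcotangent_transition_r atlasM _ m ap cp) _.
rewrite Phi_coord_lsubmx Phi_coord_rshift (hcoef_change u.1 m ap cp) mxE.
(* The vertical parts agree because d/da^m = sum_l P_lm d/dc^l. *)
have -> : ccomp a u.2 m =
    \sum_l ccomp c u.2 l * tcomp c (partial a m (base p)) 0 l.
  exact: (covectorE atlasM _ _ cp).
rewrite -big_split; apply: eq_bigr => l _.
rewrite mxE Phi_coord_rshift mxE mulrDl addrAC; congr (_ + _ + _ * _).
(* [tderiv] is computed in the chart [chart_at], which is [c]. *)
by rewrite /tderiv tcomp_chart_at.
Qed.

End PhiChart.

Section PhiInverse.
Variables (R : realType) (n : nat) (M : chartedSpace R n).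
Hypothesis atlasM : smooth_atlas M.
Variable nabla : vfield M -> vfield M -> vfield M.
Hypothesis nablaP : linear_connection nabla.
Local Notation TsM := (cotangent_bundle M).
Implicit Types (a : chart M) (p : TsM).

(** In the chart [a], the inverse of Phi maps (X, Z) to
    (X, Z - sum_i X_i N_i). *)
Definition PhiV_coord a p (U : 'rV[R]_(n + n)) : 'rV[R]_(n + n) :=
  row_mx (lsubmx U)
    (\row_l (U 0 (rshift n l) - \sum_i U 0 (lshift n i) * hcoef nabla a p i l)).

Lemma PhiVK p : cancel (Phi nabla p)^-1%VF (Phi nabla p).
Proof.
move=> U; set c := chart_at (base p).
have cp : cdom c (base p) by exact: cdom_chart_at.
pose W := PhiV_coord c p (@tcomp R (n + n) TsM c p U).
apply: (@surj_lfunVK _ _ _ _ _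
  (tvec c (base p) (lsubmx W), cvec c (base p) (rsubmx W))).
apply: (tcomp_inj (cotangent_atlas atlasM) (a := c)) => //.
rewrite tcomp_Phi //= tvecK //.
apply/rowP => j; case: (split_ordP j) => [i ->|l ->].
  by rewrite Phi_coord_lshift row_mxKl mxE.
rewrite Phi_coord_rshift mxE ccomp_cvec // /W row_mxKr row_mxKl mxE.
by under [X in X + _]eq_bigr do rewrite mxE; rewrite addrC subrK.
Qed.

Lemma PhiV_tcomp a p U : cdom a (base p) ->
  tcomp a ((Phi nabla p)^-1%VF U).1 = lsubmx (@tcomp R (n + n) TsM a p U).
Proof.
by move=> ap; rewrite -[in RHS](PhiVK U) tcomp_Phi // Phi_coord_lsubmx.
Qed.

Lemma PhiV_ccomp a p U l : cdom a (base p) ->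
  ccomp a ((Phi nabla p)^-1%VF U).2 l =
  @tcomp R (n + n) TsM a p U 0 (rshift n l) -
  \sum_i @tcomp R (n + n) TsM a p U 0 (lshift n i) * hcoef nabla a p i l.
Proof.
move=> ap; rewrite -[in RHS](PhiVK U) tcomp_Phi // Phi_coord_rshift mxE.
by under [X in _ - X]eq_bigr do rewrite Phi_coord_lshift; rewrite addrC addKr.
Qed.

Lemma PhiK p : cancel (Phi nabla p) (Phi nabla p)^-1%VF.
Proof.
move=> u; have cp : cdom (chart_at (base p)) (base p) by exact: cdom_chart_at.
rewrite [LHS]surjective_pairing [RHS]surjective_pairing; congr pair.
  apply: (tcomp_inj atlasM cp); rewrite PhiV_tcomp // tcomp_Phi //.
  exact: Phi_coord_lsubmx.
apply: (ccomp_inj atlasM cp) => l; rewrite PhiV_ccomp // tcomp_Phi //.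
rewrite Phi_coord_rshift mxE.
by under [X in _ - X]eq_bigr do rewrite Phi_coord_lshift; rewrite addrC addKr.
Qed.

End PhiInverse.

(** * The Norden structure of a fibre of TM + T*M *)

Section FibreAlgebra.
Variables (R : realType) (n : nat) (M : chartedSpace R n).
Variables (J : endo M) (g : biform M).
Implicit Types x : M.

Lemma gpairDl x (X Y Z : tangent x) :
  gpair g (X + Y) Z = gpair g X Z + gpair g Y Z.
Proof. by rewrite /gpair linearD add_lfunE. Qed.

Lemma gpairZl x k (X Z : tangent x) : gpair g (k *: X) Z = k * gpair g X Z.
Proof. by rewrite /gpair linearZ scale_lfunE. Qed.

Lemma gpairDr x (X Y Z : tangent x) :
  gpair g Z (X + Y) = gpair g Z X + gpair g Z Y.
Proof. by rewrite /gpair linearD. Qed.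

Lemma gpairZr x k (X Z : tangent x) : gpair g Z (k *: X) = k * gpair g Z X.
Proof. by rewrite /gpair linearZ. Qed.

Lemma gpairNl x (X Z : tangent x) : gpair g (- X) Z = - gpair g X Z.
Proof. by rewrite -scaleN1r gpairZl mulN1r. Qed.

Lemma gpairNr x (X Z : tangent x) : gpair g Z (- X) = - gpair g Z X.
Proof. by rewrite -scaleN1r gpairZr mulN1r. Qed.

Lemma gpair0r x (Z : tangent x) : gpair g Z 0 = 0.
Proof. by rewrite /gpair linear0. Qed.

Lemma endoB x (X Y : tangent x) : J x (X - Y) = J x X - J x Y.
Proof. exact: linearB. Qed.

Lemma flatB x (X Y : tangent x) : g x (X - Y) = g x X - g x Y.
Proof. exact: linearB. Qed.

Lemma flatN x (X : tangent x) : g x (- X) = - g x X.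
Proof. exact: linearN. Qed.

Hypothesis Jsq : forall x (X : tangent x), J x (J x X) = - X.
Hypothesis gsym : forall x (X Y : tangent x), gpair g X Y = gpair g Y X.
Hypothesis gnd : forall x (X : tangent x), (forall Y, gpair g X Y = 0) -> X = 0.
Hypothesis gJ : forall x (X Y : tangent x),
  gpair g (J x X) Y = gpair g X (J x Y).
(* This expresses that g_x is onto the cotangent space. *)
Hypothesis naturalVK : forall x (xi : cotangent x), g x (natural g x xi) = xi.

Lemma flat_inj x (X Y : tangent x) : g x X = g x Y -> X = Y.
Proof.
move=> E; apply/eqP; rewrite -subr_eq0; apply/eqP; apply: gnd => Z.
by rewrite gpairDl gpairNl /gpair E subrr.
Qed.

Lemma naturalK x (X : tangent x) : natural g x (g x X) = X.
Proof. by apply: flat_inj; rewrite naturalVK. Qed.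

Lemma JstarE x (A : tangent x) : Jstar J (g x A) = g x (J x A).
Proof.
apply/lfunP => Y; rewrite /Jstar comp_lfunE.
exact: (esym (gJ A Y)).
Qed.

Lemma Jstar_linear x k (xi eta : cotangent x) :
  Jstar J (k *: xi + eta) = k *: Jstar J xi + Jstar J eta.
Proof.
by apply/lfunP => Y; rewrite /Jstar !comp_lfunE !(add_lfunE, scale_lfunE)
  !comp_lfunE.
Qed.

Lemma Jhat_fun_linear x : linear (Jhat_fun J g (x := x)).
Proof.
move=> k u v; rewrite /Jhat_fun Jstar_linear; apply: f_equal2; rewrite /=.
  by rewrite linearP.
have -> : g x (k *: u.1 + v.1) = k *: g x u.1 + g x v.1 by exact: linearP.
by rewrite opprD addrACA scalerBr.
Qed.

Lemma JhatE x (u : bigtangent x) : Jhat J g x u = Jhat_fun J g u.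
Proof. by rewrite /Jhat linfunE_linear //; exact: Jhat_fun_linear. Qed.

(** In terms of A = natural xi, the second component of Jhat (X, A) is
    X - J A. *)
Lemma Jhat_natural x (u : bigtangent x) :
  natural g x (Jhat J g x u).2 = u.1 - J x (natural g x u.2).
Proof.
by apply: flat_inj; rewrite naturalVK JhatE /= flatB -JstarE naturalVK.
Qed.

Lemma Jhat_sq x (u : bigtangent x) : Jhat J g x (Jhat J g x u) = - u.
Proof.
rewrite JhatE /Jhat_fun JhatE /= Jsq; case: u => X xi /=; congr pair.
rewrite -{1}(naturalVK xi) JstarE -flatB JstarE -flatB endoB Jsq opprB.
by rewrite addrCA subrr addr0 flatN naturalVK.
Qed.

Lemma ghat_sym x (u v : bigtangent x) : ghat J g u v = ghat J g v u.
Proof.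
rewrite /ghat (gsym u.1) (gsym (natural g x u.2) (natural _ _ _)).
rewrite (gsym (J x u.1)) (gsym (natural g x u.2) (J x v.1)); ring.
Qed.

Lemma ghat_Jhat x (u v : bigtangent x) :
  ghat J g (Jhat J g x u) v = ghat J g u (Jhat J g x v).
Proof.
rewrite /ghat !Jhat_natural !JhatE /= !Jsq.
rewrite !(gpairDl, gpairDr, gpairNl, gpairNr) !gJ !Jsq !gpairNr.
by field.
Qed.

Lemma ghat_linear_r x (u : bigtangent x) :
  linear (ghat J g u : bigtangent x -> R^o).
Proof.
move=> k v w; rewrite /ghat /= !linearP !(gpairDr, gpairZr) /=.
rewrite /GRing.scale /=; ring.
Qed.

(** Testing [u] against the covectors gives A = - J X / 2, and against the
    vectors X = - J A / 2; hence 5/4 X = 0. *)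
Lemma ghat_nondegenerate x (u : bigtangent x) :
  (forall v, ghat J g u v = 0) -> u = 0.
Proof.
case: u => X xi H; set A := natural g x xi.
have HA : A = - 2^-1 *: J x X.
  apply/eqP; rewrite -subr_eq0; apply/eqP; apply: gnd => Y.
  have := H (0, g x Y); rewrite /ghat /= naturalK !linear0 !gpair0r -/A.
  rewrite mulr0 add0r addr0 gpairDl gpairNl gpairZl => <-; ring.
have HX : X = - 2^-1 *: J x A.
  apply/eqP; rewrite -subr_eq0; apply/eqP; apply: gnd => Y.
  have := H (Y, 0); rewrite /ghat /= !linear0 !gpair0r -/A.
  rewrite mulr0 !addr0 gpairDl gpairNl gpairZl gJ => <-; ring.
have X0 : X = 0.
  have : (1 + 2^-1 * 2^-1) *: X = 0.
    rewrite scalerDl scale1r {1}HX HA linearZ /= Jsq !scalerN scalerA.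
    by rewrite !mulNr mulrN opprK addNr.
  move/eqP; rewrite scaler_eq0 => /orP[|/eqP//].
  by rewrite gt_eqF // addr_gt0 // mulr_gt0 // invr_gt0.
have A0 : A = 0 by rewrite HA X0 linear0 scaler0.
by rewrite X0 -(naturalVK xi) -/A A0 linear0.
Qed.

End FibreAlgebra.

(** * J, g and the inverse of g in a chart *)

Section Coordinates.
Variables (R : realType) (n : nat) (M : chartedSpace R n).
Hypothesis atlasM : smooth_atlas M.
Variables (J : endo M) (g : biform M).
Implicit Types (x : M) (a : chart M).

(** The matrix of [g] in the coordinate frame of the chart [a]. *)
Definition gram a x : 'M[R]_n :=
  \matrix_(i, j) gpair g (partial a i x) (partial a j x).

Lemma flat_coord a x (X : tangent x) l : cdom a x ->
  ccomp a (g x X) l = (tcomp a X *m gram a x) 0 l.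
Proof.
move=> ax; rewrite mxE /ccomp -/(gpair g X (partial a l x)).
rewrite [in LHS](tangent_sum_partial atlasM X ax).
rewrite /gpair linear_sum sum_lfunE; apply: eq_bigr => i _.
by rewrite linearZ scale_lfunE mxE.
Qed.

Lemma gpair_coord a x (X Y : tangent x) : cdom a x ->
  gpair g X Y = \sum_l (\sum_i tcomp a X 0 i * gpair g (partial a i x)
    (partial a l x)) * tcomp a Y 0 l.
Proof.
move=> ax; rewrite /gpair (covectorE atlasM _ _ ax); apply: eq_bigr => l _.
rewrite flat_coord // mxE; congr (_ * _); apply: eq_bigr => i _.
by rewrite mxE.
Qed.

Lemma endo_coord a x (X : tangent x) l : cdom a x ->
  tcomp a (J x X) 0 l =
  \sum_i tcomp a X 0 i * tcomp a (J x (partial a i x)) 0 l.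
Proof.
move=> ax; rewrite [in LHS](tangent_sum_partial atlasM X ax).
rewrite linear_sum tcomp_sum summxE; apply: eq_bigr => i _.
by rewrite linearZ tcompZ mxE.
Qed.

Lemma Jstar_coord a x (xi : cotangent x) l : cdom a x ->
  ccomp a (Jstar J xi) l =
  \sum_m ccomp a xi m * tcomp a (J x (partial a l x)) 0 m.
Proof.
by move=> ax; rewrite /ccomp /Jstar comp_lfunE -(covectorE atlasM _ _ ax).
Qed.

Hypothesis gnd : forall x (X : tangent x), (forall Y, gpair g X Y = 0) -> X = 0.

Lemma gram_unit a x : cdom a x -> gram a x \in unitmx.
Proof.
move=> ax; apply: unitmx_of_inj => v v0.
rewrite -(tvecK atlasM v ax) (gnd (X := tvec a x v)) ?tcomp0 // => Y.
rewrite /gpair (covectorE atlasM _ _ ax) big1 // => l _.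
by rewrite flat_coord // tvecK // v0 mxE mul0r.
Qed.

(** The map [flat] is onto: the vector whose components are y G^-1, with y
    those of [xi] and G the matrix of [g], is sent to [xi]. *)
Lemma natural_rinv x (xi : cotangent x) : g x (natural g x xi) = xi.
Proof.
set c := chart_at x; have cx : cdom c x by exact: cdom_chart_at.
apply: (@surj_lfunVK _ _ _ _ _
  (tvec c x ((\row_i ccomp c xi i) *m invmx (gram c x)))).
apply: (ccomp_inj atlasM cx) => l.
by rewrite flat_coord // tvecK // mulmxKV ?gram_unit // mxE.
Qed.

Lemma natural_coord a x (xi : cotangent x) : cdom a x ->
  tcomp a (natural g x xi) = (\row_i ccomp a xi i) *m invmx (gram a x).
Proof.
move=> ax.
have -> : \row_i ccomp a xi i = tcomp a (natural g x xi) *m gram a x.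
  by apply/rowP => l; rewrite -flat_coord // natural_rinv mxE.
by rewrite mulmxK // gram_unit.
Qed.

End Coordinates.

(** * Smooth sections along a chart of the cotangent bundle *)

Section SmoothSections.
Variables (R : realType) (n : nat) (M : chartedSpace R n).
Hypothesis atlasM : smooth_atlas M.
Variables (J : endo M) (g : biform M).
Variable nabla : vfield M -> vfield M -> vfield M.
Hypothesis nablaP : linear_connection nabla.
Hypothesis sJ : smooth_endo J.
Hypothesis sg : smooth_biform g.
Hypothesis gnd : forall x (X : tangent x), (forall Y, gpair g X Y = 0) -> X = 0.
Local Notation TsM := (cotangent_bundle M).
Variable a : chart M.

Let O := @cimg R (n + n) TsM a setT.
Let pt (w : 'rV[R]_(n + n)) : TsM := @cinv R (n + n) TsM a w.

Let oO : open O.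
Proof. exact: mopenT (cotangent_atlas atlasM) a. Qed.

Let cdom_pt w : O w -> cdom a (base (pt w)).
Proof. by move=> /(cimg_cinv (cotangent_atlas atlasM))[]. Qed.

(** Smoothness of a family of tangent vectors of [M] indexed by the
    coordinates [w] of the points of T*M in the chart [a], the vector at [w]
    being tangent to [M] at the base point. *)
Definition smooth_tangent (X : forall w, tangent (base (pt w))) :=
  forall l, smooth_on O (fun w => tcomp a (X w) 0 l : R^o).

(** The same for covectors of [M]. *)
Definition smooth_cotangent (xi : forall w, cotangent (base (pt w))) :=
  forall l, smooth_on O (fun w => ccomp a (xi w) l : R^o).

(** The same for tangent vectors of T*M, at the point with coordinates [w]. *)
Definition smooth_tangent_cotangent (U : forall w, tangent (pt w)) :=
  forall j, smooth_on O
    (fun w => @tcomp R (n + n) TsM a (pt w) (U w) 0 j : R^o).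

(** Smooth functions on [M] are smooth on T*M. *)
Lemma smooth_pullback (f : M -> R) :
  smooth_on (cimg a setT) (f \o cinv a : 'rV[R]_n -> R^o) ->
  smooth_on O (fun w => f (base (pt w)) : R^o).
Proof.
move=> sf; have oT := mopenT atlasM a.
have := smooth_comp_lsubmx oT sf.
by rewrite -(cimg_cotangent atlasM).
Qed.

Arguments smooth_pullback : clear implicits.

Lemma smooth_hcoef i l : smooth_on O (fun w => hcoef nabla a (pt w) i l : R^o).
Proof.
apply: smooth_sum => // k _; apply: smoothM => //.
  apply: smooth_ext oO _ (smooth_coord O (rshift n k)) => w Ow.
  by rewrite ccomp_cvec ?mxE //; exact: cdom_pt.
apply: (smooth_pullback (fun z => christoffel nabla a z k i l)).
have oa := mopen_cdom atlasM a.
have sp i' : smooth_vfield (cdom a) (fun z => partial a i' z).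
  exact: smooth_vfield_partial.
have := smooth_vfield_coord a k oa (nabla_smooth nablaP oa (sp i) (sp l)).
by rewrite cimgT.
Qed.

Lemma smooth_gpair (X Y : forall w, tangent (base (pt w))) :
  smooth_tangent X -> smooth_tangent Y ->
  smooth_on O (fun w => gpair g (X w) (Y w) : R^o).
Proof.
move=> sX sY.
have H : smooth_on O (fun w => \sum_l (\sum_i tcomp a (X w) 0 i *
    gpair g (partial a i (base (pt w))) (partial a l (base (pt w)))) *
    tcomp a (Y w) 0 l : R^o).
  apply: smooth_sum => // l _; apply: smoothM => //.
  apply: smooth_sum => // i _; apply: smoothM => //.
  exact: (smooth_pullback (fun z => gpair g (partial a i z) (partial a l z))
    (sg a i l)).
apply: smooth_ext oO _ H => w Ow.
by rewrite -(gpair_coord atlasM g) //; exact: cdom_pt.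
Qed.

Lemma smooth_J (X : forall w, tangent (base (pt w))) : smooth_tangent X ->
  smooth_tangent (fun w => J _ (X w)).
Proof.
move=> sX l.
have H : smooth_on O (fun w => \sum_i tcomp a (X w) 0 i *
    tcomp a (J _ (partial a i (base (pt w)))) 0 l : R^o).
  apply: smooth_sum => // i _; apply: smoothM => //.
  have oa := mopenT atlasM a.
  exact: (smooth_pullback (fun z => tcomp a (J z (partial a i z)) 0 l)
    (smooth_row_coord l oa (sJ a i))).
apply: smooth_ext oO _ H => w Ow.
by rewrite -(endo_coord atlasM J) //; exact: cdom_pt.
Qed.

Lemma smooth_flat (X : forall w, tangent (base (pt w))) : smooth_tangent X ->
  smooth_cotangent (fun w => g _ (X w)).
Proof.
move=> sX l; apply: smooth_gpair => // k.
apply: smooth_ext oO _ (smooth_cst _ (delta_mx 0 l 0 k : R^o)) => w Ow.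
by rewrite tcomp_partial //; exact: cdom_pt.
Qed.

Lemma smooth_Jstar (xi : forall w, cotangent (base (pt w))) :
  smooth_cotangent xi -> smooth_cotangent (fun w => Jstar J (xi w)).
Proof.
move=> sxi l.
have H : smooth_on O (fun w => \sum_m ccomp a (xi w) m *
    tcomp a (J _ (partial a l (base (pt w)))) 0 m : R^o).
  apply: smooth_sum => // m _; apply: smoothM => //.
  have oa := mopenT atlasM a.
  exact: (smooth_pullback (fun z => tcomp a (J z (partial a l z)) 0 m)
    (smooth_row_coord m oa (sJ a l))).
apply: smooth_ext oO _ H => w Ow.
by rewrite -(Jstar_coord atlasM J) //; exact: cdom_pt.
Qed.

Lemma smooth_natural (xi : forall w, cotangent (base (pt w))) :
  smooth_cotangent xi -> smooth_tangent (fun w => natural g _ (xi w)).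
Proof.
move=> sxi l.
have sG i j : smooth_on O (fun w => gram g a (base (pt w)) i j : R^o).
  apply: smooth_ext oO _ (smooth_pullback
    (fun z => gpair g (partial a i z) (partial a j z)) (sg a i j)) => w _.
  by rewrite mxE.
have uG w : O w -> gram g a (base (pt w)) \in unitmx.
  by move=> Ow; apply: gram_unit => //; exact: cdom_pt.
have sI := smooth_invmx oO uG sG.
have H : smooth_on O (fun w => \sum_k ccomp a (xi w) k *
    invmx (gram g a (base (pt w))) k l : R^o).
  by apply: smooth_sum => // k _; apply: smoothM => //; exact: sI.
apply: smooth_ext oO _ H => w Ow.
rewrite (natural_coord atlasM gnd) ?mxE; last exact: cdom_pt.
by apply: eq_bigr => k _; rewrite mxE.
Qed.

Lemma smooth_Jhat (u : forall w, bigtangent (base (pt w))) :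
  smooth_tangent (fun w => (u w).1) -> smooth_cotangent (fun w => (u w).2) ->
  smooth_tangent (fun w => (Jhat J g _ (u w)).1) /\
  smooth_cotangent (fun w => (Jhat J g _ (u w)).2).
Proof.
move=> s1 s2; split=> l.
  apply: smooth_ext oO _ (smooth_J s1 l) => w _.
  by rewrite JhatE.
apply: smooth_ext oO _ (smoothB oO (smooth_flat s1 l) (smooth_Jstar s2 l)).
by move=> w _; rewrite JhatE /Jhat_fun /ccomp add_lfunE opp_lfunE.
Qed.

Lemma smooth_ghat (u v : forall w, bigtangent (base (pt w))) :
  smooth_tangent (fun w => (u w).1) -> smooth_cotangent (fun w => (u w).2) ->
  smooth_tangent (fun w => (v w).1) -> smooth_cotangent (fun w => (v w).2) ->
  smooth_on O (fun w => ghat J g (u w) (v w) : R^o).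
Proof.
move=> u1 u2 v1 v2.
have su := smooth_natural u2; have sv := smooth_natural v2.
have c2 := @smooth_cst R (n + n) R^o O (2^-1 : R).
apply: (smoothD oO); last exact: smooth_gpair.
apply: (smoothD oO).
  apply: (smoothD oO); first exact: smooth_gpair.
  by apply: (smoothM oO c2); apply: smooth_gpair => //; exact: smooth_J.
by apply: (smoothM oO c2); apply: smooth_gpair => //; exact: smooth_J.
Qed.

Lemma smooth_Phi (u : forall w, bigtangent (base (pt w))) :
  smooth_tangent (fun w => (u w).1) -> smooth_cotangent (fun w => (u w).2) ->
  smooth_tangent_cotangent (fun w => Phi nabla (pt w) (u w)).
Proof.
move=> s1 s2 j; case: (split_ordP j) => [i ->|l ->].
  apply: smooth_ext oO _ (s1 i) => w Ow.
  by rewrite tcomp_Phi ?Phi_coord_lshift //; exact: cdom_pt.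
have H : smooth_on O (fun w => \sum_i tcomp a (u w).1 0 i *
    hcoef nabla a (pt w) i l + ccomp a (u w).2 l : R^o).
  apply: (smoothD oO) => //; apply: smooth_sum => // i _.
  by apply: smoothM => //; exact: smooth_hcoef.
apply: smooth_ext oO _ H => w Ow.
by rewrite tcomp_Phi ?Phi_coord_rshift ?mxE //; exact: cdom_pt.
Qed.

Lemma smooth_PhiV (U : forall w, tangent (pt w)) :
  smooth_tangent_cotangent U ->
  smooth_tangent (fun w => ((Phi nabla (pt w))^-1%VF (U w)).1) /\
  smooth_cotangent (fun w => ((Phi nabla (pt w))^-1%VF (U w)).2).
Proof.
move=> sU; split=> l.
  apply: smooth_ext oO _ (sU (lshift n l)) => w Ow.
  by rewrite PhiV_tcomp ?mxE //; exact: cdom_pt.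
have H : smooth_on O (fun w =>
    @tcomp R (n + n) TsM a (pt w) (U w) 0 (rshift n l) -
    \sum_i @tcomp R (n + n) TsM a (pt w) (U w) 0 (lshift n i) *
      hcoef nabla a (pt w) i l : R^o).
  apply: (smoothB oO) => //; apply: smooth_sum => // i _.
  by apply: smoothM => //; exact: smooth_hcoef.
apply: smooth_ext oO _ H => w Ow.
by rewrite PhiV_ccomp //; exact: cdom_pt.
Qed.

Lemma smooth_partial_cotangent i :
  smooth_tangent_cotangent (fun w => @partial R (n + n) TsM a i (pt w)).
Proof.
move=> j.
apply: smooth_ext oO _
  (@smooth_cst R (n + n) R^o O (delta_mx 0 i 0 j : R)) => w Ow.
by rewrite (tcomp_partial (cotangent_atlas atlasM)) //; exact: cdom_pt.
Qed.

End SmoothSections.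

(** * The transported structure *)

Theorem proposition4p2 (R : realType) (n : nat) (M : chartedSpace R n)
    (J : endo M) (g : biform M) (nabla : vfield M -> vfield M -> vfield M) :
  norden_manifold J g ->
  linear_connection nabla ->
  norden_manifold (Jtilde nabla J g) (gtilde nabla J g).
Proof.
move=> [manM [[sJ Jsq] [[sg [gsym gnd]] gJ]]] nablaP.
have atlasM : smooth_atlas M by have [h1 [h2 [h3 [h4 _]]]] := manM.
have natK := natural_rinv atlasM gnd.
have gtE p U V : gpair (gtilde nabla J g) U V =
    ghat J g ((Phi nabla p)^-1%VF U) ((Phi nabla p)^-1%VF V).
  have lr U' : linear (fun V' => ghat J g ((Phi nabla p)^-1%VF U')
      ((Phi nabla p)^-1%VF V') : R^o).
    by move=> k V1 V2; rewrite linearP; exact: ghat_linear_r.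
  rewrite /gpair /gtilde linfunE_linear; first exact: linfunE_linear.
  move=> k U1 U2; apply/lfunP => V'.
  rewrite add_lfunE scale_lfunE !linfunE_linear //.
  rewrite !(ghat_sym J gsym _ ((Phi nabla p)^-1%VF V')).
  by rewrite linearP ghat_linear_r.
have JtE p U : Jtilde nabla J g p U =
    Phi nabla p (Jhat J g (base p) ((Phi nabla p)^-1%VF U)).
  by rewrite /Jtilde !comp_lfunE.
split; first exact: cotangent_manifold.
split.
  split=> [a i|p U].
    have oO := mopenT (cotangent_atlas atlasM) a.
    apply: (smooth_row oO) => j.
    have [s1 s2] := smooth_PhiV atlasM nablaP
      (@smooth_partial_cotangent _ _ _ atlasM a i).
    have [t1 t2] := smooth_Jhat atlasM sJ sg s1 s2.
    apply: smooth_ext oO _ (smooth_Phi atlasM nablaP t1 t2 j) => w _.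
    by rewrite JtE.
  rewrite !JtE PhiK // Jhat_sq // -[in RHS](PhiVK atlasM nablaP U).
  exact: linearN.
split.
  split=> [a i j|].
    have oO := mopenT (cotangent_atlas atlasM) a.
    have [s1 s2] := smooth_PhiV atlasM nablaP
      (@smooth_partial_cotangent _ _ _ atlasM a i).
    have [t1 t2] := smooth_PhiV atlasM nablaP
      (@smooth_partial_cotangent _ _ _ atlasM a j).
    apply: smooth_ext oO _ (smooth_ghat atlasM sJ sg gnd s1 s2 t1 t2) => w _.
    by rewrite gtE.
  split=> [p U V|p U H]; first by rewrite !gtE ghat_sym.
  rewrite -(PhiVK atlasM nablaP U) [X in Phi _ _ X](_ : _ = 0) ?linear0 //.
  apply: (ghat_nondegenerate Jsq gnd gJ natK) => v.
  by rewrite -(PhiK atlasM nablaP v) -gtE H.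
by move=> p U V; rewrite !gtE !JtE !PhiK // ghat_Jhat.
Qed.
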